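(* Let $G=(V,E,\nu,\mu)$ be a weighted graph such that $M:=\sup_{x\in V}\frac{\deg_x}{\nu_x}<\infty$. Suppose that $G$ has a positive spectral gap, i.e. $\inf\sigma(\Delta)>0$. Then for any $p\in(1,\infty)$, $$\||Df|\|_{\ell^p(E,\mu)}\approx\|\Delta^{1/2}f\|_{\ell^p(V,\nu)}\approx\|f\|_{\ell^p(V,\nu)},\quad\forall f\in\mathcal{C}_0(V).$$ Moreover, for any $p\in[2,\infty)$ there is a constant $C>0$ such that $$\||\nabla f|\|_{\ell^p(V,\nu)}\le C\|\Delta^{1/2}f\|_{\ell^p(V,\nu)},\quad\forall f\in\mathcal{C}_0(V).$$
   Context: A weighted graph $G=(V,E,\nu,\mu)$ consists of a connected, locally finite, undirected graph $(V,E)$ (each vertex has finitely many neighbors; $x\sim y$ means $\{x,y\}\in E$), vertex weights $\nu:V\to(0,\infty)$, $x\mapsto\nu_x$, and symmetric edge weights $\mu:E\to(0,\infty)$, $\{x,y\}\mapsto\mu_{xy}=\mu_{yx}$, extended to $V\times V$ by $\mu_{xy}=0$ if $\{x,y\}\notin E$. Put $\deg_x:=\sum_{y\in V}\mu_{xy}$. $\mathcal{C}_0(V)$ denotes the finitely supported real functions on $V$. The spaces $\ell^p(V,\nu)$ and $\ell^p(E,\mu)$ are the usual $\ell^p$ spaces over the discrete measure spaces $(V,\nu)$ and $(E,\mu)$. The Laplacian is $\Delta f(x)=\frac1{\nu_x}\sum_{y}\mu_{xy}(f(x)-f(y))$; when $\sup_x\deg_x/\nu_x<\infty$ it is a bounded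 nonnegative self-adjoint operator on $\ell^2(V,\nu)$, with $\ell^2(V,\nu)$-spectrum $\sigma(\Delta)$; $\Delta^{1/2}$ is its nonnegative square root. For $f:V\to\mathbb{R}$: $|Df|:E\to\mathbb{R}$ is defined by $|Df|(\{x,y\})=|f(x)-f(y)|$, so $\||Df|\|_{\ell^p(E,\mu)}^p=\sum_{\{x,y\}\in E}\mu_{xy}|f(x)-f(y)|^p$; and $|\nabla f|(x):=\left(\frac1{2\nu_x}\sum_y|f(x)-f(y)|^2\mu_{xy}\right)^{1/2}$ for $x\in V$. For functionals $F,H\ge0$, $F(f)\approx H(f)$ for all $f$ in a class means there are constants $c,C>0$ independent of $f$ with $cH(f)\le F(f)\le CH(f)$ for all such $f$. *)

(* Defs.v *)
From Stdlib Require Relation_Operators.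
From mathcomp Require Import all_boot all_order all_algebra.
From mathcomp Require Import all_classical all_reals all_analysis.

Set Implicit Arguments.
Unset Strict Implicit.
Unset Printing Implicit Defensive.
Import Order.TTheory GRing.Theory Num.Theory.
Local Open Scope classical_set_scope.
Local Open Scope ring_scope.

(* Edges are unordered pairs [set x; y]; a singleton [set x; x] (a loop) is
   allowed, and loops only contribute to deg.  [mu] is meaningful on [edge]
   only; [wt] below is its extension by zero to V x V. *)
Record weighted_graph (R : realType) (V : choiceType) := WeightedGraph {
  edge : set (set V);
  edge_pair : forall e, edge e -> exists x y, e = [set x; y];
  locally_finite : forall x, finite_set [set y | edge [set x; y]];
  connected_graph : forall x y,
    Relation_Operators.clos_refl_trans V (fun u v => edge [set u; v]) x y;
  nu : V -> R;
  nu_gt0 : forall x, 0 < nu x;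
  mu : set V -> R;
  mu_gt0 : forall e, edge e -> 0 < mu e
}.

Section Lp.
Variables (R : realType) (T : choiceType).

(* The l^p norm, 0 < p < +oo, over the discrete measure space D with
   weights w; it is +oo when f is not in l^p(D, w). *)
Definition lpnorm (D : set T) (w : T -> R) (p : R) (f : T -> R) : \bar R :=
  ((\esum_(x in D) (w x * `|f x| `^ p)%:E) `^ p^-1)%E.

Definition finitely_supported : set (T -> R) :=
  [set f | finite_set [set x | f x != 0]].

End Lp.

(* Operators on the real Hilbert space l^2(V, w).  They are total maps on
   functions V -> R of which only the values on [l2] matter. *)
Section L2.
Variables (R : realType) (V : choiceType) (w : V -> R).
Implicit Types (f g : V -> R) (S T : (V -> R) -> (V -> R)).

Definition l2 : set (V -> R) := [set f | (lpnorm setT w 2 f < +oo)%E].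

(* The absolutely convergent series \sum_x w x * f x * g x for f, g in l2. *)
Definition l2inner f g : R :=
  let h x := w x * f x * g x in
  fine (\esum_(x in setT) (h^\+ x)%:E) - fine (\esum_(x in setT) (h^\- x)%:E).

Definition bounded_operator T : Prop :=
  [/\ forall f, l2 f -> l2 (T f),
      forall (a : R) f g, l2 f -> l2 g ->
        T (fun x => a * f x + g x) = (fun x => a * T f x + T g x) &
      exists C : R, forall f, l2 f ->
        (lpnorm setT w 2 (T f) <= C%:E * lpnorm setT w 2 f)%E].

Definition self_adjoint T : Prop :=
  forall f g, l2 f -> l2 g -> l2inner (T f) g = l2inner f (T g).

Definition nonnegative_operator T : Prop :=
  forall f, l2 f -> 0 <= l2inner (T f) f.

Definition minus_scalar T (lambda : R) f : V -> R :=
  fun x => T f x - lambda * f x.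

Definition resolvent_set T : set R := [set lambda | exists S,
  bounded_operator S /\
  forall f, l2 f -> S (minus_scalar T lambda f) = f /\
                    minus_scalar T lambda (S f) = f].

(* The real spectrum; for a bounded self-adjoint T it is the whole spectrum. *)
Definition spectrum T : set R := ~` resolvent_set T.

Definition nonnegative_sqrt T : set ((V -> R) -> (V -> R)) :=
  [set S | [/\ bounded_operator S, self_adjoint S, nonnegative_operator S &
               forall f, l2 f -> S (S f) = T f]].

(* If T is bounded, self-adjoint and nonnegative, such an S exists and its
   values on [l2] are unique; the default is never used in that case. *)
Definition op_sqrt T : (V -> R) -> (V -> R) :=
  xget (fun f => f) (nonnegative_sqrt T).

End L2.

Section Graph.
Variables (R : realType) (V : choiceType) (G : weighted_graph R V).
Implicit Type f : V -> R.

Definition wt (x y : V) : R :=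
  if [set x; y] \in edge G then mu G [set x; y] else 0.

(* The sums over y have finite support by local finiteness. *)
Definition deg (x : V) : R := \sum_(y \in [set: V]) wt x y.

Definition laplacian f : V -> R :=
  fun x => (nu G x)^-1 * \sum_(y \in [set: V]) (wt x y * (f x - f y)).

Definition sqrt_laplacian : (V -> R) -> (V -> R) := op_sqrt (nu G) laplacian.

(* |Df|, as a function of the unordered pair; see [edge_diffE]. *)
Definition edge_diff f (e : set V) : R :=
  xget 0 [set r | exists x y, e = [set x; y] /\ r = `|f x - f y|].

Definition gradient f : V -> R :=
  fun x => Num.sqrt ((2 * nu G x)^-1 *
    \sum_(y \in [set: V]) (`|f x - f y| ^+ 2 * wt x y)).

Definition lpV (p : R) f : \bar R := lpnorm setT (nu G) p f.

Definition lpE (p : R) (F : set V -> R) : \bar R := lpnorm (edge G) (mu G) p F.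

Lemma edge_diffE f x y : edge_diff f [set x; y] = `|f x - f y|.
Proof.
rewrite /edge_diff; case: xgetP => [_ -> [u [v [euv ->]]]|]; last first.
  by move=> /(_ `|f x - f y|) []; exists x, y.
have xuv : [set u; v] x by rewrite -euv; left.
have yuv : [set u; v] y by rewrite -euv; right.
have uxy : [set x; y] u by rewrite euv; left.
have vxy : [set x; y] v by rewrite euv; right.
case: xuv => /= ex; case: yuv => /= ey; rewrite ex ey in uxy vxy *.
- by case: vxy => ->.
- by [].
- by rewrite distrC.
- by case: uxy => ->.
Qed.

End Graph.

Definition equivalent_on (R : realType) (T : Type) (A : set T)
    (F H : T -> \bar R) : Prop :=
  exists c C : R, [/\ 0 < c, 0 < C & forall f, A f ->
    (c%:E * H f <= F f)%E /\ (F f <= C%:E * H f)%E].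

(* Main.v *)
Require Import Defs.
From mathcomp Require Import all_boot all_order all_algebra.
From mathcomp Require Import all_classical all_reals all_analysis.
From mathcomp Require Import finmap ring lra.
Set Implicit Arguments.
Unset Strict Implicit.
Unset Printing Implicit Defensive.
Import Order.TTheory GRing.Theory Num.Theory.
Import numFieldNormedType.Exports.
Local Open Scope classical_set_scope.
Local Open Scope ring_scope.

(** Write N_p(f) for the sum of nu |f|^p over the vertices.  All the norms in the
    theorem are p-th roots of such sums, and every estimate is made on the sums
    themselves; convexity of the power function replaces Minkowski's inequality.

    Fix c > 0 with deg <= c nu / 2 and let P = 1 - Delta / c ([walk]).  This is
    the transition operator of a lazy random walk reversible with respect to nu,
    so Jensen's inequality makes it a contraction for every N_p.  Laziness gives
    more for p = 2: the variance of one step dominates the Dirichlet energy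
    ([walk_energy]).  If 0 is not in the spectrum then N_2(f) is at most a
    multiple of N_2(Delta f), hence of the energy, and it follows that
    N_2(P f) <= k N_2(f) with k < 1 ([walk_gap2]).  Jensen's inequality carries
    this strict contraction to p > 2 and duality to 1 < p < 2 ([walk_gap]).

    The square root of 1 - P is 1 - Y, where Y is the limit of the iterates
    Y_0 = 0, Y_(n+1) = (P + Y_n^2) / 2.  Convexity shows by induction that each
    Y_n contracts N_p at least as strongly as P does, and so does Y, by Fatou's
    lemma ([rtlim_lpow]).  For p = 2 the increments Y_(n+1) - Y_n decay
    geometrically, so the limit exists on l^2, is symmetric and solves
    Y = (P + Y^2) / 2.  As 1 - Y is coercive, sqrt c (1 - Y) is the only
    nonnegative square root of Delta on l^2 ([op_sqrtE]).

    Now Delta^(1/2) f = sqrt c (f - Y f), with Y a strict contraction of N_p, and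
    therefore N_p(Delta^(1/2) f) is comparable to N_p(f) ([lpow_absorb]).  The same
    argument applied to Delta f = c (f - P f) bounds N_p(f) by N_p(Delta f), which
    is at most a multiple of the p-energy, the p-th power of the norm of |Df|;
    the reverse bound is immediate as degrees are bounded.  For p >= 2 the variance
    estimate gives |grad f|^2 <= c P(f^2) pointwise, and Jensen's inequality
    bounds the norm of |grad f| by that of f. *)

(** * Convexity of power functions *)

Section RealInequalities.
Variable R : realType.
Implicit Types (s t u a b p : R).

(** The graph of u |-> u^s lies above its tangent at t; this is Young's
    inequality for the product u t^(s - 1). *)
Lemma powR_tangent s t u : 1 < s -> 0 <= t -> 0 <= u ->
  t `^ s + s * t `^ (s - 1) * (u - t) <= u `^ s.
Proof.
move=> s1 t0 u0; have s0 : 0 < s by lra.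
have sN0 : s != 0 by rewrite gt_eqF.
have s1N0 : s - 1 != 0 by rewrite gt_eqF//; lra.
pose q := s / (s - 1).
have q0 : 0 < q by rewrite divr_gt0//; lra.
have sq : s^-1 + q^-1 = 1 by rewrite /q invf_div; field.
have := @conjugate_powR _ u (t `^ (s - 1)) s q u0 (powR_ge0 _ _) s0 q0 sq.
rewrite -powRrM (_ : (s - 1) * q = s); last by rewrite /q; field.
have ht : t * t `^ (s - 1) = t `^ s by rewrite mulr_powRB1.
rewrite (_ : u `^ s / s + t `^ s / q = (u `^ s + (s - 1) * t `^ s) / s); last first.
  by rewrite /q; field; rewrite sN0.
rewrite ler_pdivlMr// -subr_ge0 => h.
rewrite -subr_ge0; move: h; congr (0 <= _); rewrite -ht; ring.
Qed.

(** Jensen's inequality for weights of total mass at most 1: average the tangent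
    inequality at the mean t; the missing mass only helps since t >= 0. *)
Lemma jensen_powR (I : Type) (r : seq I) (b u : I -> R) s : 1 <= s ->
  (forall i, 0 <= b i) -> (forall i, 0 <= u i) -> \sum_(i <- r) b i <= 1 ->
  (\sum_(i <- r) b i * u i) `^ s <= \sum_(i <- r) b i * u i `^ s.
Proof.
rewrite le_eqVlt => /predU1P[<-|s1] b0 u0 b1.
  rewrite powRr1 ?sumr_ge0// => [|i _]; last by rewrite mulr_ge0.
  by apply: ler_sum => i _; rewrite powRr1.
set t := \sum_(i <- r) b i * u i.
have t0 : 0 <= t by rewrite sumr_ge0// => i _; rewrite mulr_ge0.
have ht : t * t `^ (s - 1) = t `^ s by rewrite mulr_powRB1//; lra.
have : \sum_(i <- r) b i * (t `^ s + s * t `^ (s - 1) * (u i - t))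
       <= \sum_(i <- r) b i * u i `^ s.
  by apply: ler_sum => i _; rewrite ler_wpM2l// powR_tangent.
apply: le_trans.
rewrite (eq_bigr (fun i => (t `^ s - s * t `^ (s - 1) * t) * b i
           + s * t `^ (s - 1) * (b i * u i))); last by move=> i _; ring.
rewrite big_split/= -!mulr_sumr -/t.
have -> : s * t `^ (s - 1) * t = s * t `^ s by rewrite -ht; ring.
have T0 := powR_ge0 t s; set B := \sum_(i <- r) b i in b1 *.
rewrite -subr_ge0 (_ : _ - _ = (s - 1) * t `^ s * (1 - B)); last by ring.
by rewrite !mulr_ge0//; lra.
Qed.

(** Convexity of the power function in the unnormalised form
    (a + b)^p <= (1 - t)^(1 - p) a^p + t^(1 - p) b^p.  Letting t tend to 0 the
    first constant tends to 1, which makes the inequality a substitute for the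
    triangle inequality that needs no p-th roots. *)
Lemma powRD_convex p t a b : 1 <= p -> 0 < t < 1 -> 0 <= a -> 0 <= b ->
  (a + b) `^ p <= (1 - t) `^ (1 - p) * a `^ p + t `^ (1 - p) * b `^ p.
Proof.
move=> p1 /andP[t0 t1] a0 b0; have t'0 : 0 < 1 - t by lra.
pose c (i : bool) := if i then t else 1 - t.
pose u (i : bool) := if i then b / t else a / (1 - t).
have : (\sum_(i <- [:: false; true]) c i * u i) `^ p
       <= \sum_(i <- [:: false; true]) c i * u i `^ p.
  apply: jensen_powR => //.
  - by case; rewrite /c; lra.
  - by case; rewrite /u divr_ge0//; lra.
  - by rewrite !big_cons big_nil /c; lra.
rewrite !big_cons !big_nil !addr0 /c /u.
have hp x y : 0 < x -> 0 <= y -> x * (y / x) `^ p = x `^ (1 - p) * y `^ p.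
  move=> x0 y0; rewrite powRM// ?invr_ge0 ?(ltW x0)//.
  rewrite -(powR_inv1 (ltW x0)) -powRrM mulN1r powRB; last first.
    by apply/implyP => _; rewrite gt_eqF.
  by rewrite powRr1 ?(ltW x0)// powRN; ring.
rewrite !hp// [(1 - t) * _]mulrC [t * _]mulrC !divfK ?gt_eqF//.
Qed.

End RealInequalities.

(** * Sums of nonnegative families *)

Section ExtendedSums.
Variables (R : realType) (T : choiceType).
Local Open Scope ereal_scope.
Implicit Types (D : set T) (a : T -> \bar R).

Lemma esumZ D a (k : R) : (0 <= k)%R -> (forall x, 0 <= a x) ->
  \esum_(x in D) (k%:E * a x) = k%:E * \esum_(x in D) a x.
Proof.
have le_esumZ (c : R) (b : T -> \bar R) : (0 <= c)%R -> (forall x, 0 <= b x) ->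
    \esum_(x in D) (c%:E * b x) <= c%:E * \esum_(x in D) b x.
  move=> c0 b0; apply: ge_ereal_sup => _ [X [finX XD] <-].
  rewrite -ge0_mule_fsumr//; apply: lee_wpmul2l; first by rewrite lee_fin.
  by apply: ereal_sup_ubound; exists X.
rewrite le_eqVlt => /predU1P[<- a0|k0 a0].
  by rewrite mul0e esum1// => x _; rewrite mul0e.
apply/eqP; rewrite eq_le; apply/andP; split; first by rewrite le_esumZ// ltW.
have kV0 : (0 <= k^-1)%R by rewrite invr_ge0 ltW.
have ka0 x : 0 <= k%:E * a x by rewrite mule_ge0// lee_fin ltW.
have h : \esum_(x in D) a x <= k^-1%:E * \esum_(x in D) (k%:E * a x).
  apply: le_trans (le_esumZ _ _ kV0 ka0).
  by apply: le_esum => x _; rewrite muleA -EFinM mulVf ?gt_eqF// mul1e.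
have k0' : 0 <= k%:E by rewrite lee_fin ltW.
have := lee_wpmul2l k0' h.
by rewrite muleA -EFinM mulfV ?gt_eqF// mul1e.
Qed.

Lemma esum_fin_supp (r : seq T) (h : T -> R) : uniq r -> (forall x, 0 <= h x)%R ->
  (forall x, x \notin r -> h x = 0%R) ->
  \esum_(x in setT) (h x)%:E = (\sum_(x <- r) h x)%:E.
Proof.
move=> ur h0 hr; rewrite (_ : setT = [set` r] `|` ~` [set` r]); last by rewrite setUv.
rewrite (esumID [set` r]); last by move=> x _; rewrite lee_fin.
rewrite setUv !setTI [X in _ + X]esum1 ?adde0; last first.
  by move=> x /= /negP xr; rewrite hr.
rewrite esum_fset//; last by move=> x _; rewrite lee_fin.
by rewrite -fsbig_seq// sumEFin.
Qed.

Lemma exchange_esum (U : choiceType) (a : T -> U -> \bar R) :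
  (forall x y, 0 <= a x y) ->
  \esum_(x in setT) \esum_(y in setT) a x y =
  \esum_(y in setT) \esum_(x in setT) a x y.
Proof.
move=> a0; rewrite !esum_esum//.
rewrite (reindex_esum (setT `*`` (fun=> setT)) _ (fun k => (k.2, k.1)))//.
split=> //=.
- by move=> [x y] [x' y'] _ _ [-> ->].
- by move=> [x y] _; exists (y, x).
Qed.

End ExtendedSums.

(** * Power sums, the p-th powers of weighted l^p norms *)

Section PowerSums.
Variables (R : realType) (T : choiceType) (w : T -> R).
Hypothesis w_gt0 : forall x, 0 < w x.
Implicit Types (f g h : T -> R) (p : R).

Definition lpow p f : \bar R := \esum_(x in setT) (w x * `|f x| `^ p)%:E.

Let w_ge0 x : 0 <= w x. Proof. exact: ltW. Qed.

Let term_ge0 p f x : 0 <= w x * `|f x| `^ p.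
Proof. by rewrite mulr_ge0// powR_ge0. Qed.

Lemma lpow_ge0 p f : (0 <= lpow p f)%E.
Proof. by apply: esum_ge0 => x _; rewrite lee_fin. Qed.

Lemma le_lpow p f g : 0 <= p -> (forall x, `|f x| <= `|g x|) ->
  (lpow p f <= lpow p g)%E.
Proof.
move=> p0 fg; apply: le_esum => x _.
by rewrite lee_fin ler_wpM2l// ge0_ler_powR// nnegrE.
Qed.

Lemma lpow0 p : p != 0 -> lpow p (fun=> 0) = 0%E.
Proof. by move=> p0; apply: esum1 => x _; rewrite normr0 powR0// mulr0. Qed.

Lemma lpowZ p (a : R) f :
  lpow p (fun x => a * f x) = ((`|a| `^ p)%:E * lpow p f)%E.
Proof.
rewrite /lpow -esumZ ?powR_ge0//; last by move=> x; rewrite lee_fin.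
by apply: eq_esum => x _; rewrite normrM powRM// -EFinM mulrCA.
Qed.

Lemma lpow_point p f x : ((w x * `|f x| `^ p)%:E <= lpow p f)%E.
Proof.
apply: esum_ge; exists [set x]; last by rewrite fsbig_set1.
by split => //; exact: finite_set1.
Qed.

Lemma lpowD_convex p (t : R) f g : 1 <= p -> 0 < t < 1 ->
  (lpow p (fun x => f x + g x)%R
    <= ((1 - t) `^ (1 - p))%:E * lpow p f + (t `^ (1 - p))%:E * lpow p g)%E.
Proof.
move=> p1 t01; have p0 : 0 <= p by lra.
rewrite /lpow -!esumZ ?powR_ge0//; try by move=> x; rewrite lee_fin.
rewrite -esumD; try by move=> x _; rewrite -EFinM lee_fin mulr_ge0// powR_ge0.
apply: le_esum => x _; rewrite -!EFinM -EFinD lee_fin.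
apply: (@le_trans _ _ (w x * (`|f x| + `|g x|) `^ p)).
  by rewrite ler_wpM2l// ge0_ler_powR// ?nnegrE ?addr_ge0// ler_normD.
rewrite mulrCA (mulrCA (t `^ _)) -mulrDr ler_wpM2l//.
exact: powRD_convex.
Qed.

Lemma lpowD p f g : 1 <= p ->
  (lpow p (fun x => f x + g x)%R
    <= (2^-1 `^ (1 - p))%:E * (lpow p f + lpow p g))%E.
Proof.
move=> p1; have h2 : 0 < (2^-1 : R) < 1 by lra.
apply: (le_trans (lpowD_convex f g p1 h2)).
rewrite (_ : 1 - 2^-1 = 2^-1 :> R); last by lra.
by rewrite ge0_muleDr ?lpow_ge0.
Qed.

Lemma lpow_half p f g : 1 <= p ->
  (lpow p (fun x => 2^-1 * (f x + g x))%R <= 2^-1%:E * (lpow p f + lpow p g))%E.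
Proof.
move=> p1; rewrite lpowZ ger0_norm ?invr_ge0//.
have h : (0 <= (2^-1 `^ p : R)%:E)%E by rewrite lee_fin powR_ge0.
apply: (le_trans (lee_wpmul2l h (lpowD f g p1))).
rewrite muleA -EFinM -powRD; last by apply/implyP => _; rewrite gt_eqF.
by rewrite addrCA subrr addr0 powRr1.
Qed.

(** This is how a strict contraction T yields a bound of f by f - T f: apply
    [lpowD_convex] with t so small that (1 - t)^(1 - p) k is still below 1, and
    absorb the first term.  The absorption needs the power sum of f to be
    finite. *)
Lemma lpow_absorb p (k : R) : 1 <= p -> 0 <= k < 1 ->
  exists2 C : R, 0 < C & forall f g h, (lpow p f < +oo)%E ->
    (forall x, f x = g x + h x) -> (lpow p g <= k%:E * lpow p f)%E ->
    (lpow p f <= C%:E * lpow p h)%E.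
Proof.
move=> p1 /andP[k0 k1]; have p0 : 0 < p by lra.
(* s is chosen so that k < s^p <= s^(p - 1). *)
pose s := ((1 + k) / 2) `^ p^-1.
have s0 : 0 < s by rewrite powR_gt0//; lra.
have sp : s `^ p = (1 + k) / 2.
  by rewrite -powRrM mulVf ?gt_eqF// powRr1//; lra.
have s1 : s < 1.
  rewrite ltNge; apply/negP => s1.
  have : 1 <= s `^ p by rewrite -(powRr0 s) ler_powR// ltW.
  by rewrite sp; lra.
have hs : s `^ (1 - p) * k < 1.
  rewrite -opprB powRN mulrC ltr_pdivrMr ?(powR_gt0 _ s0)// mul1r.
  have : s `^ p <= s `^ (p - 1) by apply: ger_powR; [rewrite s0 ltW|lra].
  by rewrite sp; lra.
set a := s `^ (1 - p) in hs; set b := (1 - s) `^ (1 - p).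
have b0 : 0 < b by rewrite powR_gt0; lra.
exists (b / (1 - a * k)); first by rewrite divr_gt0//; lra.
move=> f g h ff fgh gk.
have t01 : 0 < 1 - s < 1 by apply/andP; split; lra.
have := lpowD_convex g h p1 t01.
rewrite -(funext fgh) (_ : 1 - (1 - s) = s); last by lra.
rewrite -/a -/b => H.
have a0 : (0 <= a%:E)%E by rewrite lee_fin powR_ge0.
have {}H : (lpow p f <= a%:E * (k%:E * lpow p f) + b%:E * lpow p h)%E.
  by apply: le_trans H _; rewrite leeD2r// lee_wpmul2l.
have hh := lpow_ge0 p h.
have := lpow_ge0 p f; move: ff H.
case: (lpow p f) => [F| |]// _.
case: (lpow p h) hh => [h'| |]// h0 H F0; last first.
  by rewrite mulry gtr0_sg ?mul1e ?leey// divr_gt0//; lra.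
move: H; rewrite -!EFinM -EFinD !lee_fin => H.
by rewrite mulrAC ler_pdivlMr; lra.
Qed.

Lemma lpow_fatou p (f : nat -> T -> R) g (A : \bar R) : 1 < p ->
  (forall x, f k x @[k --> \oo] --> g x) -> (forall k, lpow p (f k) <= A)%E ->
  (lpow p g <= A)%E.
Proof.
move=> p1 fg fA.
have := le_trans (lpow_ge0 _ _) (fA 0).
case: A fA => [A| |] fA A0; [|by rewrite leey|by move: A0; rewrite leeNy_eq].
apply: ge_ereal_sup => _ [X [finX _] <-].
rewrite fsumEFin// lee_fin fsbig_finite//=; set r := (X in \sum_(_ <- X) _).
(* The tangent inequality at |g x| makes the estimate linear in |f k x|. *)
have step k : \sum_(x <- r) w x * `|g x| `^ p
    + \sum_(x <- r) w x * (p * `|g x| `^ (p - 1)) * (`|f k x| - `|g x|) <= A.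
  rewrite -lee_fin; apply: le_trans (fA k).
  rewrite -big_split/= -sumEFin.
  apply: (@le_trans _ _ (\sum_(x <- r) (w x * `|f k x| `^ p)%:E)%E).
    apply: lee_sum => x _; rewrite lee_fin -mulrA -mulrDr ler_wpM2l//.
    exact: powR_tangent.
  rewrite /r -fsbig_finite//; apply: esum_ge; exists X => //; split => //.
suff h : (\sum_(x <- r) w x * `|g x| `^ p
    + \sum_(x <- r) w x * (p * `|g x| `^ (p - 1)) * (`|f k x| - `|g x|))
    @[k --> \oo] --> \sum_(x <- r) w x * `|g x| `^ p.
  exact: (ler_cvg_to h (cvg_cst A) (nearW _ step)).
rewrite -[X in _ --> X]addr0; apply: cvgD; first exact: cvg_cst.
rewrite [X in _ --> X](_ : 0 =
  \sum_(x <- r) w x * (p * `|g x| `^ (p - 1)) * (`|g x| - `|g x|)); last first.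
  by rewrite big1// => x _; rewrite subrr mulr0.
apply: cvg_big => [|x _]; first exact: add_continuous.
apply: cvgMr; apply: cvgB; last exact: cvg_cst.
by apply: cvg_norm; exact: fg.
Qed.

Lemma lpow_fin_supp p f : p != 0 -> finitely_supported f -> (lpow p f < +oo)%E.
Proof.
move=> p0 ff; rewrite /lpow (@esum_fin_supp _ _ (fset_set [set x | f x != 0])).
- by rewrite ltry.
- exact: fset_uniq.
- by [].
- move=> x; rewrite in_fset_set// notin_setE/= => /negP/negPn/eqP ->.
  by rewrite normr0 powR0// mulr0.
Qed.

End PowerSums.

Lemma poweR_leM (R : realType) (p k : R) (a b : \bar R) : 0 < p -> 0 <= k ->
  (0 <= a)%E -> (0 <= b)%E -> (a <= k%:E * b)%E ->
  (a `^ p^-1 <= (k `^ p^-1)%:E * b `^ p^-1)%E.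
Proof.
move=> p0 k0 a0 b0 ab; rewrite -poweR_EFin -poweRM ?lee_fin//.
have pV0 : 0 <= p^-1 by rewrite invr_ge0 ltW.
apply: gt0_ler_poweR => //; rewrite in_itv/= leey ?andbT//.
by rewrite mule_ge0// lee_fin.
Qed.

(** * The inner product of l^2 *)

Section SignedSums.
Variables (R : realType) (T : choiceType).
Implicit Types (a b h : T -> R).

(** [l2inner w f g] is by definition the [ssum] of the family w f g. *)
Definition ssum h : R :=
  fine (\esum_(x in setT) (h^\+ x)%:E) - fine (\esum_(x in setT) (h^\- x)%:E).

Definition abs_summable h := (\esum_(x in setT) (`|h x|)%:E < +oo)%E.

Lemma le_abs_summable h a : (forall x, `|h x| <= a x) ->
  (\esum_(x in setT) (a x)%:E < +oo)%E -> abs_summable h.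
Proof.
by move=> ha; apply: le_lt_trans; apply: le_esum => x _; rewrite lee_fin.
Qed.

Lemma esum_real_fin_num a : (forall x, 0 <= a x) ->
  (\esum_(x in setT) (a x)%:E < +oo)%E ->
  (\esum_(x in setT) (a x)%:E)%E \is a fin_num.
Proof.
by move=> a0 af; rewrite ge0_fin_numE// esum_ge0// => x _; rewrite lee_fin.
Qed.

(** Any splitting of h into a difference of nonnegative summable functions
    computes its sum; the rules of calculation below choose suitable ones. *)
Lemma ssumB a b h : (forall x, 0 <= a x) -> (forall x, 0 <= b x) ->
  (\esum_(x in setT) (a x)%:E < +oo)%E -> (\esum_(x in setT) (b x)%:E < +oo)%E ->
  (forall x, h x = a x - b x) ->
  ssum h = fine (\esum_(x in setT) (a x)%:E) - fine (\esum_(x in setT) (b x)%:E).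
Proof.
move=> a0 b0 af bf hab.
have p0 := @funrpos_ge0 _ _ h; have n0 := @funrneg_ge0 _ _ h.
have pa x : h^\+ x <= a x.
  by rewrite /funrpos ge_max a0 andbT hab lerBlDr lerDl.
have nb x : h^\- x <= b x.
  by rewrite /funrneg ge_max b0 andbT hab opprB lerBlDr lerDl.
have pf : (\esum_(x in setT) (h^\+ x)%:E < +oo)%E.
  by apply: le_lt_trans af; apply: le_esum => x _; rewrite lee_fin.
have nf : (\esum_(x in setT) (h^\- x)%:E < +oo)%E.
  by apply: le_lt_trans bf; apply: le_esum => x _; rewrite lee_fin.
have : (\esum_(x in setT) (h^\+ x)%:E + \esum_(x in setT) (b x)%:E =
        \esum_(x in setT) (h^\- x)%:E + \esum_(x in setT) (a x)%:E)%E.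
  rewrite -!esumD; try by move=> x _; rewrite lee_fin.
  apply: eq_esum => x _; rewrite -!EFinD; congr EFin.
  rewrite /funrpos /funrneg hab; case: (leP (a x - b x) 0) => h0.
    by rewrite (max_idPl _); lra.
  by rewrite (max_idPr _); lra.
move/(congr1 fine); rewrite !fineD ?esum_real_fin_num// => e.
by rewrite /ssum; lra.
Qed.

Lemma abs_summable_pos h : abs_summable h ->
  (\esum_(x in setT) (h^\+ x)%:E < +oo)%E.
Proof.
apply: le_lt_trans; apply: le_esum => x _; rewrite lee_fin /funrpos.
by rewrite ge_max normr_ge0 ler_norm.
Qed.

Lemma abs_summable_neg h : abs_summable h ->
  (\esum_(x in setT) (h^\- x)%:E < +oo)%E.
Proof.
apply: le_lt_trans; apply: le_esum => x _; rewrite lee_fin /funrneg.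
by rewrite ge_max normr_ge0 -normrN ler_norm.
Qed.

Lemma ge0_ssum h : (forall x, 0 <= h x) ->
  ssum h = fine (\esum_(x in setT) (h x)%:E).
Proof.
move=> h0; rewrite /ssum [X in _ - fine X]esum1 ?subr0.
  congr fine; apply: eq_esum => x _; congr EFin.
  exact/max_idPl/h0.
move=> x _; congr EFin.
by apply/max_idPr; rewrite oppr_le0.
Qed.

Lemma ssumD h1 h2 : abs_summable h1 -> abs_summable h2 ->
  ssum (fun x => h1 x + h2 x) = ssum h1 + ssum h2.
Proof.
move=> s1 s2.
have [p1 n1] := (abs_summable_pos s1, abs_summable_neg s1).
have [p2 n2] := (abs_summable_pos s2, abs_summable_neg s2).
have eD a b : (forall x, 0 <= a x) -> (forall x, 0 <= b x) ->
    (\esum_(x in setT) (a x + b x)%:E =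
     \esum_(x in setT) (a x)%:E + \esum_(x in setT) (b x)%:E)%E.
  move=> a0 b0; rewrite -esumD; try by move=> x _; rewrite lee_fin.
  by apply: eq_esum => x _; rewrite EFinD.
rewrite (@ssumB (fun x => h1^\+ x + h2^\+ x) (fun x => h1^\- x + h2^\- x)).
- by rewrite !eD ?fineD ?esum_real_fin_num /ssum//; lra.
- by move=> x; rewrite addr_ge0// ?funrpos_ge0.
- by move=> x; rewrite addr_ge0// ?funrneg_ge0.
- by rewrite eD// lte_add_pinfty.
- by rewrite eD// lte_add_pinfty.
- have e h x : h x = h^\+ x - h^\- x by rewrite -[in LHS](funrposBneg h).
  by move=> x; rewrite [in LHS](e h1) [in LHS](e h2); lra.
Qed.

Lemma ssumZ c h : abs_summable h -> ssum (fun x => c * h x) = c * ssum h.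
Proof.
move=> s; have [p n] := (abs_summable_pos s, abs_summable_neg s).
have eZ d a : 0 <= d -> (forall x, 0 <= a x) ->
    (\esum_(x in setT) (d * a x)%:E = d%:E * \esum_(x in setT) (a x)%:E)%E.
  by move=> d0 a0; rewrite -esumZ//; move=> x; rewrite lee_fin.
have [p0 n0] := (@funrpos_ge0 _ _ h, @funrneg_ge0 _ _ h).
rewrite /ssum; case: (leP 0 c) => c0.
  rewrite ge0_funrposM// ge0_funrnegM// !eZ// !fineM ?esum_real_fin_num//.
  by rewrite -mulrBr.
rewrite le0_funrposM ?(ltW c0)// le0_funrnegM ?(ltW c0)//.
have c0' : 0 <= - c by lra.
by rewrite !eZ// !fineM ?esum_real_fin_num//=; ring.
Qed.

End SignedSums.

Section InnerProduct.
Variables (R : realType) (V : choiceType) (w : V -> R).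
Hypothesis w_gt0 : forall x, 0 < w x.
Implicit Types f g h : V -> R.

Let w_ge0 x : 0 <= w x. Proof. exact: ltW. Qed.

Lemma powR_norm2 (x : R) : `|x| `^ 2 = x ^+ 2.
Proof. by rewrite powR_mulrn// real_normK// num_real. Qed.

Lemma lpow2E f : lpow w 2 f = (\esum_(x in setT) (w x * f x ^+ 2)%:E)%E.
Proof. by apply: eq_esum => x _; rewrite powR_norm2. Qed.

Lemma l2P f : l2 w f <-> (lpow w 2 f < +oo)%E.
Proof.
rewrite /l2/= /lpnorm -/(lpow w 2 f); split.
  by apply: lty_poweRy; rewrite invr_neq0.
exact: poweR_lty.
Qed.

Lemma l2_lin (a b : R) f g : l2 w f -> l2 w g -> l2 w (fun x => a * f x + b * g x).
Proof.
move=> /l2P lf /l2P lg; apply/l2P.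
have fin_mul (c : R) y : 0 <= c -> (y < +oo)%E -> (c%:E * y < +oo)%E.
  by move=> c0 y0; apply: lte_mul_pinfty => //; rewrite lee_fin.
apply: le_lt_trans (lpowD w_gt0 _ _ _) _; first by lra.
rewrite !lpowZ//; apply: (fin_mul); first exact: powR_ge0.
by apply: lte_add_pinfty; apply: (fin_mul) => //; exact: powR_ge0.
Qed.

Lemma l2_mul_summable f g : l2 w f -> l2 w g ->
  abs_summable (fun x => w x * f x * g x).
Proof.
move=> /l2P lf /l2P lg.
apply: (@le_abs_summable _ _ _ (fun x => w x * f x ^+ 2 + w x * g x ^+ 2)).
  move=> x; rewrite -mulrA normrM gtr0_norm// -mulrDr ler_wpM2l//.
  have := sqr_ge0 (f x - g x); have := sqr_ge0 (f x + g x).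
  rewrite ler_norml; have := sqr_ge0 (f x); have := sqr_ge0 (g x).
  nra.
under eq_esum do rewrite EFinD.
rewrite esumD; try by move=> x _; rewrite lee_fin mulr_ge0// sqr_ge0.
by rewrite -!lpow2E lte_add_pinfty.
Qed.

Lemma l2innerC f g : l2inner w f g = l2inner w g f.
Proof.
rewrite /l2inner (_ : (fun x => w x * f x * g x) = (fun x => w x * g x * f x))//.
by apply/funext => x; rewrite mulrAC.
Qed.

Lemma l2inner_lin (a b : R) f g h : l2 w f -> l2 w g -> l2 w h ->
  l2inner w (fun x => a * f x + b * g x) h =
  a * l2inner w f h + b * l2inner w g h.
Proof.
move=> lf lg lh; rewrite -/(ssum _).
have sZ (c : R) u : l2 w u -> abs_summable (fun x => c * (w x * u x * h x)).
  move=> lu; rewrite (_ : (fun _ => _) = (fun x => w x * (c * u x + 0 * u x) * h x)).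
    by apply: l2_mul_summable => //; exact: l2_lin.
  by apply/funext => x; ring.
rewrite -!ssumZ//; try exact: l2_mul_summable.
rewrite -ssumD; try exact: sZ.
by congr ssum; apply/funext => x; ring.
Qed.

Lemma l2inner_self f : l2 w f -> (l2inner w f f)%:E = lpow w 2 f.
Proof.
move=> /l2P lf; rewrite lpow2E.
have e : (\esum_(x in setT) (w x * f x * f x)%:E =
          \esum_(x in setT) (w x * f x ^+ 2)%:E)%E.
  by apply: eq_esum => x _; rewrite -mulrA.
have f0 x : 0 <= w x * f x * f x by rewrite -mulrA mulr_ge0// -expr2 sqr_ge0.
rewrite -e /l2inner -/(ssum _) ge0_ssum// fineK//.
by apply: esum_real_fin_num => //; rewrite e -lpow2E.
Qed.

Lemma l2inner_ge0 f : l2 w f -> 0 <= l2inner w f f.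
Proof. by move=> lf; rewrite -lee_fin l2inner_self// lpow_ge0. Qed.

Lemma l2inner_point f x : l2 w f -> w x * f x ^+ 2 <= l2inner w f f.
Proof.
by move=> lf; rewrite -lee_fin l2inner_self// -powR_norm2 lpow_point.
Qed.

Lemma l2inner_young f g : l2 w f -> l2 w g ->
  `|l2inner w f g| *+ 2 <= l2inner w f f + l2inner w g g.
Proof.
move=> lf lg.
have e (s : R) : l2inner w (fun x => 1 * f x + s * g x) (fun x => 1 * f x + s * g x)
    = l2inner w f f + 2 * s * l2inner w f g + s ^+ 2 * l2inner w g g.
  have ls := l2_lin 1 s lf lg.
  rewrite l2inner_lin// (l2innerC f) (l2innerC g) !l2inner_lin// (l2innerC g f).
  by ring.
have := l2inner_ge0 (l2_lin 1 1 lf lg); have := l2inner_ge0 (l2_lin 1 (-1) lf lg).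
by rewrite !e mulr2n; case: (ger0P (l2inner w f g)) => _; lra.
Qed.

Lemma l2inner_CS f g : l2 w f -> l2 w g ->
  l2inner w f g ^+ 2 <= l2inner w f f * l2inner w g g.
Proof.
move=> lf lg; set a := l2inner w f g.
have e (s t : R) : 0 <= s ^+ 2 * l2inner w f f + 2 * s * t * a + t ^+ 2 * l2inner w g g.
  have ls := l2_lin s t lf lg; have := l2inner_ge0 ls.
  rewrite l2inner_lin// (l2innerC f) (l2innerC g) !l2inner_lin// (l2innerC g f) -/a.
  by congr (0 <= _); ring.
have [g0|g0] := eqVneq (l2inner w g g) 0.
  suff -> : a = 0 by rewrite expr0n/= g0 mulr0.
  rewrite /a /l2inner -/(ssum _) (_ : (fun x => _) = (fun=> 0)).
    rewrite ge0_ssum//; rewrite ?esum1 ?ltry//.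
  apply/funext => x; have := l2inner_point x lg; rewrite g0.
  rewrite pmulr_rle0// => gx; have /eqP : g x ^+ 2 == 0.
    by rewrite eq_le gx sqr_ge0.
  by move/eqP; rewrite sqrf_eq0 => /eqP ->; rewrite mulr0.
have {g0} g0 : 0 < l2inner w g g by rewrite lt_def g0 l2inner_ge0.
have := e (l2inner w g g) (- a).
rewrite (_ : _ + _ =
  l2inner w g g * (l2inner w f f * l2inner w g g - a ^+ 2)); last by ring.
by rewrite pmulr_rge0// subr_ge0.
Qed.

End InnerProduct.

(** * The square root of 1 - B for a strict contraction B *)

Section BoundedOperators.
Variables (R : realType) (V : choiceType) (w : V -> R).
Hypothesis w_gt0 : forall x, 0 < w x.
Implicit Types (f g : V -> R) (S : (V -> R) -> V -> R).

Lemma lpnorm2K f : ((lpnorm setT w 2 f) `^ 2 = lpow w 2 f)%E.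
Proof.
rewrite /lpnorm -/(lpow w 2 f) -poweRrM mulVf// poweRe1//.
exact: lpow_ge0.
Qed.

Lemma bounded_operator_lpow S : bounded_operator w S ->
  exists2 C : R, 0 < C & forall f, l2 w f -> (lpow w 2 (S f) <= C%:E * lpow w 2 f)%E.
Proof.
move=> [_ _ [C SC]]; exists ((`|C| + 1) ^+ 2).
  by rewrite exprn_gt0// ltr_wpDl.
move=> f lf; have C0 : 0 <= `|C| + 1 by rewrite addr_ge0.
have h : (lpnorm setT w 2 (S f) <= (`|C| + 1)%:E * lpnorm setT w 2 f)%E.
  apply: (le_trans (SC f lf)); apply: lee_wpmul2r; first exact: poweR_ge0.
  by rewrite lee_fin (le_trans (ler_norm _))// lerDl.
rewrite -!lpnorm2K -(@powR_mulrn _ _ 2)// -poweR_EFin -poweRM ?lee_fin ?poweR_ge0//.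
apply: gt0_ler_poweR => //; rewrite in_itv/= leey andbT ?poweR_ge0//.
by rewrite mule_ge0 ?poweR_ge0.
Qed.

Lemma bounded_operator_lin S (a b : R) f g : bounded_operator w S ->
  l2 w f -> l2 w g ->
  S (fun x => a * f x + b * g x) = (fun x => a * S f x + b * S g x).
Proof.
move=> [_ Slin _] lf lg.
have l0 : l2 w (fun=> 0) by apply/l2P; rewrite lpow0 ?ltry.
have S0 : S (fun=> 0) = fun=> 0.
  have := Slin 1 _ _ l0 l0.
  rewrite (_ : (fun x => 1 * 0 + 0) = (fun=> 0 : R)); last first.
    by apply/funext => x; rewrite mulr0 addr0.
  move=> e; apply/funext => x; have := congr1 (@^~ x) e => /=; lra.
have lbg : l2 w (fun x => b * g x).
  have := l2_lin w_gt0 b 0 lg lg; congr (l2 w).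
  by apply/funext => x; rewrite mul0r addr0.
rewrite (Slin a f (fun x => b * g x))//.
have -> : (fun x => b * g x) = (fun x => b * g x + 0).
  by apply/funext => x; rewrite addr0.
rewrite (Slin b g (fun=> 0))// S0.
by apply/funext => x; rewrite addr0.
Qed.

End BoundedOperators.

Lemma mule_halfD (R : realType) (x : \bar R) : (0 <= x)%E ->
  (2^-1%:E * (x + x) = x)%E.
Proof.
move=> x0; rewrite ge0_muleDr// -ge0_muleDl ?lee_fin// -EFinD.
by rewrite (_ : 2^-1 + 2^-1 = 1 :> R) ?mul1e//; lra.
Qed.

Lemma le_geometric_eq0 (R : realType) (a C k : R) : 0 <= k < 1 -> 0 <= a ->
  (forall n, a <= C * k ^+ n) -> a = 0.
Proof.
move=> /andP[k0 k1] a0 h; apply/eqP; rewrite eq_le a0 andbT.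
have h0 : C * k ^+ n @[n --> \oo] --> C * 0.
  by apply: cvgMr; apply: cvg_expr; rewrite ger0_norm.
rewrite mulr0 in h0.
exact: (ler_cvg_to (cvg_cst a) h0 (nearW _ h)).
Qed.

Section SquareRoot.
Variables (R : realType) (V : choiceType) (w : V -> R).
Hypothesis w_gt0 : forall x, 0 < w x.
Variable B : (V -> R) -> V -> R.
Implicit Types (f g : V -> R) (S : (V -> R) -> V -> R).

Hypothesis B_lin : forall a b f g,
  B (fun x => a * f x + b * g x) = (fun x => a * B f x + b * B g x).
Hypothesis B_sym : forall f g, l2 w f -> l2 w g ->
  l2inner w (B f) g = l2inner w f (B g).
Variable k : R.
Hypothesis k01 : 0 < k < 1.
Hypothesis B_contr : forall f, (lpow w 2 (B f) <= k%:E * lpow w 2 f)%E.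

Let w_ge0 x : 0 <= w x. Proof. exact: ltW. Qed.
Let k_gt0 : 0 < k. Proof. by case/andP: k01. Qed.
Let k_ge0 : 0 <= k. Proof. exact: ltW. Qed.
Let k_lt1 : k < 1. Proof. by case/andP: k01. Qed.

(** The iterates Y_n for the fixed point equation Y = (B + Y^2) / 2, which is
    (1 - Y)^2 = 1 - B. *)
Fixpoint rt n f : V -> R :=
  if n is n'.+1 then fun x => 2^-1 * (B f x + rt n' (rt n' f) x) else fun=> 0.

Lemma rt_lin n a b f g :
  rt n (fun x => a * f x + b * g x) = (fun x => a * rt n f x + b * rt n g x).
Proof.
elim: n f g => [|n IH] f g /=; apply/funext => x; first by ring.
by rewrite B_lin !IH; ring.
Qed.

Lemma rtB n f g x : rt n (fun y => f y - g y) x = rt n f x - rt n g x.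
Proof.
rewrite (_ : (fun y => _) = (fun y => 1 * f y + (-1) * g y)).
  by rewrite rt_lin; ring.
by apply/funext => y; ring.
Qed.

(** Every l^p contraction property of B passes to the iterates with the same
    constant, since (c + c^2) / 2 <= c for c <= 1. *)
Lemma rt_lpow p (c : R) : 1 <= p -> 0 <= c <= 1 ->
  (forall f, (lpow w p (B f) <= c%:E * lpow w p f)%E) ->
  forall n f, (lpow w p (rt n f) <= c%:E * lpow w p f)%E.
Proof.
move=> p1 /andP[c0 c1] Bc; elim=> [|n IH] f /=.
  rewrite lpow0; last by rewrite gt_eqF//; lra.
  by rewrite mule_ge0 ?lpow_ge0.
have L0 := lpow_ge0 w_gt0 p f.
have cL0 : (0 <= c%:E * lpow w p f)%E by rewrite mule_ge0.
apply: le_trans (lpow_half w_gt0 _ _ p1) _.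
rewrite -[leRHS](mule_halfD cL0); apply: lee_wpmul2l; first by rewrite lee_fin.
apply: leeD; first exact: Bc.
apply: le_trans (IH _) _; apply: lee_wpmul2l; first by rewrite lee_fin.
apply: le_trans (IH _) _.
by rewrite -[leRHS]mul1e lee_wpmul2r// lee_fin.
Qed.

(** The two terms of
    Y_(n+1)^2 - Y_n^2 = Y_(n+1) (Y_(n+1) - Y_n) + (Y_(n+1) - Y_n) Y_n
    each gain a factor k, and their average is the next increment. *)
Lemma rt_increment n f :
  (lpow w 2 (fun x => rt n.+1 f x - rt n f x)%R <= (k ^+ n)%:E * lpow w 2 f)%E.
Proof.
have le12 : 1 <= (2 : R) by lra.
have kk : 0 <= k <= 1 by rewrite k_ge0 ltW.
elim: n f => [|n IH] f.
  have := rt_lpow le12 kk B_contr 1 f.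
  rewrite (_ : (fun x => rt 1 f x - rt 0 f x) = rt 1 f); last first.
    by apply/funext => x /=; rewrite subr0.
  move/le_trans; apply; apply: lee_wpmul2r; first exact: lpow_ge0.
  by rewrite lee_fin expr0 ltW.
have -> : (fun x => rt n.+2 f x - rt n.+1 f x) = (fun x => 2^-1 *
    (rt n.+1 (fun y => rt n.+1 f y - rt n f y) x +
     (rt n.+1 (rt n f) x - rt n (rt n f) x))).
  have rtS m g x : rt m.+1 g x = 2^-1 * (B g x + rt m (rt m g) x) by [].
  apply/funext => x; rewrite rtB (rtS n.+1 f x) [in LHS](rtS n f x).
  by ring.
have L0 := lpow_ge0 w_gt0 2 f.
have cL0 : (0 <= (k ^+ n.+1)%:E * lpow w 2 f)%E by rewrite 
  mule_ge0// lee_fin exprn_ge0.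
apply: le_trans (lpow_half w_gt0 _ _ le12) _.
rewrite -[leRHS](mule_halfD cL0); apply: lee_wpmul2l; first by rewrite lee_fin.
have kn0 : 0 <= k ^+ n by rewrite exprn_ge0.
apply: leeD.
  apply: le_trans (rt_lpow le12 kk B_contr _ _) _.
  by rewrite exprS EFinM -muleA lee_wpmul2l ?lee_fin.
apply: le_trans (IH _) _.
rewrite exprSr EFinM -muleA lee_wpmul2l ?lee_fin//.
exact: rt_lpow.
Qed.

(** Summation of the geometric increments: one peels off the first increment with
    [lpowD_convex], the parameter t being chosen so that the constant in front of
    the remaining sum, multiplied by k, is still below 1. *)
Lemma rt_cauchy : exists2 K : R, 0 < K & forall m n f,
  (lpow w 2 (fun x => rt (n + m)%N f x - rt n f x)%R
     <= (K * k ^+ n)%:E * lpow w 2 f)%E.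
Proof.
have [k0 k1] := andP k01; pose t := (1 + k) / 2.
have t01 : 0 < t < 1 by rewrite /t; lra.
have [t0 t1] := andP t01.
pose a := (1 - t) `^ (1 - 2); pose b := t `^ (1 - 2).
have a0 : 0 < a by rewrite powR_gt0//; lra.
have b0 : 0 < b by rewrite powR_gt0//; lra.
(* Here b = 1 / t with t strictly between k and 1. *)
have bk : b * k < 1.
  rewrite /b (_ : 1 - 2 = -1); last by lra.
  by rewrite powR_inv1 ?ltW// mulrC ltr_pdivrMr// /t; lra.
pose K := a / (1 - b * k).
have K0 : 0 < K by rewrite divr_gt0//; lra.
have aK : a + b * K * k = K by rewrite /K; field; rewrite gt_eqF//; lra.
exists K => //; elim=> [|m IH] n f.
  rewrite addn0 (_ : (fun x => _) = (fun=> 0)); last first.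
    by apply/funext => x; rewrite subrr.
  rewrite lpow0// mule_ge0 ?lpow_ge0// lee_fin mulr_ge0 ?exprn_ge0//.
  exact: ltW.
have -> : (fun x => rt (n + m.+1) f x - rt n f x) =
    (fun x => (rt n.+1 f x - rt n f x) + (rt (n.+1 + m) f x - rt n.+1 f x)).
  by apply/funext => x; rewrite addnS addSn; ring.
have le12 : 1 <= (2 : R) by lra.
apply: le_trans (lpowD_convex w_gt0 _ _ le12 t01) _; rewrite -/a -/b.
have L0 := lpow_ge0 w_gt0 2 f.
have -> : K * k ^+ n = a * k ^+ n + b * (K * k ^+ n.+1).
  by rewrite exprS -[in LHS]aK; ring.
have kn i : 0 <= k ^+ i by exact: exprn_ge0.
have [[a0' b0'] K0'] := (ltW a0, ltW b0, ltW K0).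
have h1 : (0 <= (a * k ^+ n)%:E)%E by rewrite lee_fin; apply: mulr_ge0.
have h2 : (0 <= (b * (K * k ^+ n.+1))%:E)%E 
  by rewrite lee_fin; apply: mulr_ge0 => //; apply: mulr_ge0.
rewrite EFinD ge0_muleDl//.
rewrite (EFinM a) (EFinM b) -(muleA a%:E) -(muleA b%:E).
apply: leeD; apply: lee_wpmul2l.
- by rewrite lee_fin ltW.
- exact: rt_increment.
- by rewrite lee_fin ltW.
- exact: IH.
Qed.


Lemma cvg0_of_lpow (u : nat -> V -> R) (C : R) x :
  (forall n, (lpow w 2 (u n) <= (C * k ^+ n)%:E)%E) -> u n x @[n --> \oo] --> 0.
Proof.
move=> uC; have sq n : (u n x) ^+ 2 <= C / w x * k ^+ n.
  have := le_trans (lpow_point w 2 (u n) x) (uC n).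
  by rewrite powR_norm2 lee_fin mulrAC ler_pdivlMr// mulrC.
have h : C / w x * k ^+ n @[n --> \oo] --> C / w x * 0.
  by apply: cvgMr; apply: cvg_expr; rewrite ger0_norm.
rewrite mulr0 in h.
have h2 : (u n x) ^+ 2 @[n --> \oo] --> 0.
  apply: (squeeze_cvgr _ (cvg_cst 0) h); apply: nearW => n.
  by rewrite sqr_ge0 sq.
apply/norm_cvg0P.
have -> : (fun n => `|u n x|) = (fun n => Num.sqrt ((u n x) ^+ 2)).
  by apply/funext => n; rewrite sqrtr_sqr.
rewrite -(sqrtr0 R); apply: continuous_cvg => //; exact: sqrt_continuous.
Qed.

Definition rtlim f : V -> R := fun x => limn (fun n => rt n f x).

Lemma rt_cvg f x : l2 w f -> rt n f x @[n --> \oo] --> rtlim f x.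
Proof.
move=> lf; suff : cvgn (fun n => rt n f x) by [].
have [K K0 HK] := rt_cauchy.
pose L := l2inner w f f.
have sq n m : (rt (n + m) f x - rt n f x) ^+ 2 <= K * L / w x * k ^+ n.
  have := le_trans (lpow_point w 2 _ x) (HK m n f).
  rewrite powR_norm2 -l2inner_self// -/L lee_fin => h.
  by rewrite mulrAC ler_pdivlMr// mulrC (le_trans h)// mulrAC.
have h : K * L / w x * k ^+ n @[n --> \oo] --> K * L / w x * 0.
  by apply: cvgMr; apply: cvg_expr; rewrite ger0_norm.
rewrite mulr0 in h.
apply/cauchy_cvgP; apply: cauchy_exP => e e0.
have : \forall n \near \oo, K * L / w x * k ^+ n < e ^+ 2.
  by apply: (cvgr_lt _ h); rewrite exprn_gt0.
move=> [N _ /(_ N (leqnn N)) HN]; exists (rt N f x).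
exists N => // n /= Nn; rewrite /ball/= distrC.
rewrite -(subnKC Nn) -ltr_sqr ?nnegrE ?normr_ge0 ?(ltW e0)//.
by rewrite real_normK ?num_real// (le_lt_trans (sq _ _)).
Qed.

Lemma rtlim_err : exists2 K : R, 0 < K & forall n f, l2 w f ->
  (lpow w 2 (fun x => rtlim f x - rt n f x)%R <= (K * k ^+ n)%:E * lpow w 2 f)%E.
Proof.
have [K K0 HK] := rt_cauchy; exists K => // n f lf.
apply: (@lpow_fatou _ _ _ w_gt0 _ (fun m x => rt (n + m) f x - rt n f x)).
- by lra.
- move=> x; apply: cvgB; last exact: cvg_cst.
  have := @rt_cvg f x lf; rewrite -(cvg_shiftn n).
  by under [X in X @ _]eq_fun do rewrite addnC.
- by move=> m; exact: HK.
Qed.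

Lemma rtlim_lpow p (c : R) f : 1 < p -> 0 <= c <= 1 ->
  (forall f, (lpow w p (B f) <= c%:E * lpow w p f)%E) -> l2 w f ->
  (lpow w p (rtlim f) <= c%:E * lpow w p f)%E.
Proof.
move=> p1 c01 Bc lf; apply: (@lpow_fatou _ _ _ w_gt0 _ (fun n => rt n f)) => //.
  by move=> x; exact: rt_cvg.
by move=> n; apply: rt_lpow => //; exact: ltW.
Qed.

Let le12 : 1 <= (2 : R). Proof. by lra. Qed.
Let lt12 : 1 < (2 : R). Proof. by lra. Qed.
Let kk : 0 <= k <= 1. Proof. by rewrite k_ge0 ltW. Qed.

Lemma rt_l2 n f : l2 w f -> l2 w (rt n f).
Proof.
move=> /l2P lf; apply/l2P; apply: le_lt_trans (rt_lpow le12 kk B_contr n f) _.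
by apply: lte_mul_pinfty; rewrite ?lee_fin.
Qed.

Lemma rtlim_l2 f : l2 w f -> l2 w (rtlim f).
Proof.
move=> lf; apply/l2P; apply: le_lt_trans (rtlim_lpow lt12 kk B_contr lf) _.
by apply: lte_mul_pinfty; rewrite ?lee_fin//; apply/l2P.
Qed.

Lemma B_l2 f : l2 w f -> l2 w (B f).
Proof.
move=> /l2P lf; apply/l2P; apply: le_lt_trans (B_contr f) _.
by apply: lte_mul_pinfty; rewrite ?lee_fin.
Qed.

Lemma rtlim_lin a b f g : l2 w f -> l2 w g ->
  rtlim (fun x => a * f x + b * g x) = (fun x => a * rtlim f x + b * rtlim g x).
Proof.
move=> lf lg; apply/funext => x.
have h : rt n (fun x => a * f x + b * g x) x @[n --> \oo] -->
    a * rtlim f x + b * rtlim g x.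
  under eq_fun do rewrite rt_lin.
  by apply: cvgD; apply: cvgMr; exact: rt_cvg.
exact: (cvg_lim (@Rhausdorff R) h).
Qed.

(** The limit solves Y = (B + Y^2) / 2, that is, (1 - Y)^2 = 1 - B. *)
Lemma rtlim_eq f x : l2 w f ->
  rtlim f x = 2^-1 * (B f x + rtlim (rtlim f) x).
Proof.
move=> lf; have lY := rtlim_l2 lf.
have [K K0 HK] := rtlim_err.
have h : rt n.+1 f x @[n --> \oo] --> rtlim f x.
  by have := @rt_cvg f x lf; rewrite -cvg_shiftS.
have e0 : rt n (fun y => rtlim f y - rt n f y) x @[n --> \oo] --> 0.
  apply: (@cvg0_of_lpow (fun n => rt n (fun y => rtlim f y - rt n f y))
    (k * K * l2inner w f f)) => n.
  apply: le_trans (rt_lpow le12 kk B_contr _ _) _.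
  have k0 : (0 <= k%:E)%E by rewrite lee_fin.
  apply: le_trans (lee_wpmul2l k0 (HK n f lf)) _.
  rewrite -l2inner_self// -!EFinM lee_fin.
  by rewrite le_eqVlt; apply/orP; left; apply/eqP; ring.
have h2 : rt n.+1 f x @[n --> \oo] --> 2^-1 * (B f x + (rtlim (rtlim f) x - 0)).
  have -> : (fun n => rt n.+1 f x) = (fun n => 2^-1 * (B f x +
     (rt n (rtlim f) x - rt n (fun y => rtlim f y - rt n f y) x))).
    by apply/funext => n; rewrite rtB /=; ring.
  apply: cvgMr; apply: cvgD; first exact: cvg_cst.
  by apply: cvgB => //; exact: rt_cvg.
rewrite subr0 in h2.
exact: (cvg_unique (@Rhausdorff R) h h2).
Qed.

Lemma rt_sym n f g : l2 w f -> l2 w g ->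
  l2inner w (rt n f) g = l2inner w f (rt n g).
Proof.
have rtE m h : rt m.+1 h = (fun x => 2^-1 * B h x + 2^-1 * rt m (rt m h) x).
  by apply/funext => x /=; ring.
have l0 : l2 w (fun=> 0 : R) by apply/l2P; rewrite lpow0 ?ltry.
have i0 h : l2 w h -> l2inner w (fun=> 0) h = 0.
  move=> lh; have := l2inner_lin w_gt0 0 0 lh lh lh.
  rewrite (_ : (fun x => _) = (fun=> 0)); last by apply/funext => x; ring.
  by move=> ->; ring.
elim: n f g => [|n IH] f g lf lg; first by rewrite (l2innerC w f) !i0.
have [l1 l2'] := (B_l2 lf, rt_l2 n (rt_l2 n lf)).
have [l3 l4] := (B_l2 lg, rt_l2 n (rt_l2 n lg)).
rewrite !rtE l2inner_lin// (l2innerC w f) l2inner_lin//.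
rewrite B_sym// (l2innerC w _ f) IH//; last exact: rt_l2.
by rewrite IH//; [rewrite (l2innerC w f (rt n _))|exact: rt_l2].
Qed.

Lemma l2_sub f g : l2 w f -> l2 w g -> l2 w (fun x => f x - g x).
Proof.
move=> lf lg; have := l2_lin w_gt0 1 (-1) lf lg; congr (l2 w).
by apply/funext => x; ring.
Qed.

Lemma l2innerB f g h : l2 w f -> l2 w g -> l2 w h ->
  l2inner w (fun x => f x - g x) h = l2inner w f h - l2inner w g h.
Proof.
move=> lf lg lh; rewrite (_ : (fun x => _) = (fun x => 1 * f x + (-1) * g x)).
  by rewrite l2inner_lin//; ring.
by apply/funext => x; ring.
Qed.

Lemma rtlim_sym f g : l2 w f -> l2 w g ->
  l2inner w (rtlim f) g = l2inner w f (rtlim g).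
Proof.
move=> lf lg; apply/eqP; rewrite -subr_eq0 -sqrf_eq0; apply/eqP.
have [K K0 HK] := rtlim_err.
have errR n h : l2 w h ->
    l2inner w (fun x => rtlim h x - rt n h x) (fun x => rtlim h x - rt n h x)
    <= K * k ^+ n * l2inner w h h.
  move=> lh; have := HK n h lh.
  rewrite -!l2inner_self//; apply: l2_sub; [exact: rtlim_l2|exact: rt_l2].
have k01' : 0 <= k < 1 by rewrite k_ge0.
apply: (@le_geometric_eq0 _ _ (4 * K * l2inner w f f * l2inner w g g) k) => //.
  exact: sqr_ge0.
move=> n.
have [lYf lYg] := (rtlim_l2 lf, rtlim_l2 lg).
have [lnf lng] := (rt_l2 n lf, rt_l2 n lg).
have -> : l2inner w (rtlim f) g - l2inner w f (rtlim g) =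
   l2inner w (fun x => rtlim f x - rt n f x) g -
   l2inner w (fun x => rtlim g x - rt n g x) f.
  rewrite !l2innerB// rt_sym//.
  by rewrite (l2innerC w f (rt n g)) (l2innerC w f (rtlim g)); ring.
set u := l2inner w _ g; set v := l2inner w _ f.
have hu : u ^+ 2 <= K * k ^+ n * l2inner w f f * l2inner w g g.
  apply: le_trans (l2inner_CS w_gt0 (l2_sub lYf lnf) lg) _.
  by rewrite ler_wpM2r ?l2inner_ge0// errR.
have hv : v ^+ 2 <= K * k ^+ n * l2inner w f f * l2inner w g g.
  apply: le_trans (l2inner_CS w_gt0 (l2_sub lYg lng) lf) _.
  by rewrite [leRHS]mulrAC ler_wpM2r ?l2inner_ge0// errR.
have : (u - v) ^+ 2 <= 2 * (u ^+ 2 + v ^+ 2).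
  rewrite -subr_ge0; have := sqr_ge0 (u + v).
  by congr (0 <= _); ring.
move/le_trans; apply.
rewrite (_ : _ * k ^+ n = 2 * (K * k ^+ n * l2inner w f f * l2inner w g g +
  K * k ^+ n * l2inner w f f * l2inner w g g)); last by ring.
by rewrite ler_wpM2l// lerD.
Qed.

(** 1 - Y is coercive, so its kernel is trivial; this is what makes the square
    root unique below. *)
Lemma rtlim_coercive f : l2 w f ->
  (1 - k) / 2 * l2inner w f f <= l2inner w (fun x => f x - rtlim f x) f.
Proof.
move=> lf; have lY := rtlim_l2 lf; rewrite l2innerB//.
have Yk : l2inner w (rtlim f) (rtlim f) <= k * l2inner w f f.
  by rewrite -lee_fin EFinM !l2inner_self//; exact: rtlim_lpow.
have := l2inner_young w_gt0 lY lf; have := ler_norm (l2inner w (rtlim f) f).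
rewrite mulr2n; lra.
Qed.

(** An operator that commutes with B commutes with every iterate, hence with the
    limit by continuity. *)
Lemma rtlim_comm S f x : bounded_operator w S ->
  (forall g, l2 w g -> S (B g) = B (S g)) -> l2 w f ->
  S (rtlim f) x = rtlim (S f) x.
Proof.
move=> Sb SB lf; have [Sl2 _ _] := Sb.
have S_lin a b g h := @bounded_operator_lin _ _ w w_gt0 S a b g h Sb.
have l0 : l2 w (fun=> 0 : R) by apply/l2P; rewrite lpow0 ?ltry.
have Srt n g : l2 w g -> S (rt n g) = rt n (S g).
  elim: n g => [|n IH] g lg.
    have := S_lin 0 0 _ _ l0 l0.
    rewrite (_ : (fun x => 0 * 0 + 0 * 0) = (fun=> 0 : R)); last first.
      by apply/funext => y; ring.
    by move=> ->; apply/funext => y /=; ring.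
  rewrite (_ : rt n.+1 g = (fun x => 2^-1 * B g x + 2^-1 * rt n (rt n g) x)).
    have [l1 l2'] := (rt_l2 n lg, rt_l2 n (rt_l2 n lg)).
    rewrite S_lin//; last exact: B_l2.
    rewrite SB// IH// IH//.
    by apply/funext => y /=; ring.
  by apply/funext => y /=; ring.
have [K K0 HK] := rtlim_err.
have [C C0 HC] := bounded_operator_lpow w_gt0 Sb.
have lY := rtlim_l2 lf; have lSf := Sl2 f lf.
have e1 : S (fun y => rtlim f y - rt n f y) x @[n --> \oo] --> 0.
  apply: (@cvg0_of_lpow (fun n => S (fun y => rtlim f y - rt n f y))
    (C * K * l2inner w f f)) => n.
  apply: le_trans (HC _ _) _; first by apply: l2_sub => //; exact: rt_l2.
  have C0' : (0 <= C%:E)%E by rewrite lee_fin ltW.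
  apply: le_trans (lee_wpmul2l C0' (HK n f lf)) _.
  rewrite -l2inner_self// -!EFinM lee_fin.
  by rewrite le_eqVlt; apply/orP; left; apply/eqP; ring.
have e2 := @rt_cvg (S f) x lSf.
have e3 : S (rtlim f) x @[n --> \oo] --> 0 + rtlim (S f) x.
  rewrite (_ : (fun n => S (rtlim f) x) = (fun n : nat =>
    S (fun y => rtlim f y - rt n f y) x + rt n (S f) x)); first exact: cvgD.
  apply/funext => n; rewrite (_ : (fun y => _) =
      (fun y => 1 * rtlim f y + (-1) * rt n f y)).
    by rewrite S_lin//; [rewrite Srt//; ring|exact: rt_l2].
  by apply/funext => y; ring.
rewrite add0r in e3.
exact: (cvg_unique (@Rhausdorff R) (cvg_cst _) e3).
Qed.

Section Operator.
Variables (T : (V -> R) -> V -> R) (c : R).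
Hypothesis c_gt0 : 0 < c.
Hypothesis TE : forall f x, l2 w f -> T f x = c * (f x - B f x).

(** The square root of T = c (1 - B). *)
Definition sqrt_series f : V -> R := fun x => Num.sqrt c * (f x - rtlim f x).

Let sc_gt0 : 0 < Num.sqrt c. Proof. by rewrite sqrtr_gt0. Qed.

Let seriesE f :
  sqrt_series f = (fun x => Num.sqrt c * f x + (- Num.sqrt c) * rtlim f x).
Proof. by apply/funext => x; rewrite /sqrt_series; ring. Qed.

Lemma sqrt_series_l2 f : l2 w f -> l2 w (sqrt_series f).
Proof. by move=> lf; rewrite seriesE; apply: l2_lin => //; exact: rtlim_l2. Qed.

Lemma sqrt_series_lpow p : 1 < p -> exists2 C : R, 0 < C &
  forall f (a : R), 0 <= a <= 1 ->
  (forall f, (lpow w p (B f) <= a%:E * lpow w p f)%E) -> l2 w f ->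
  (lpow w p (sqrt_series f) <= C%:E * lpow w p f)%E.
Proof.
move=> p1; have p1' := ltW p1.
pose d := 2^-1 `^ (1 - p) : R; pose e := `|Num.sqrt c| `^ p.
have d0 : 0 < d by rewrite powR_gt0//; lra.
have e0 : 0 < e by rewrite powR_gt0// normr_gt0 gt_eqF.
exists (d * (e + e)); first by apply: mulr_gt0 => //; exact: addr_gt0.
move=> f a /andP[a0 a1] Ba lf.
have L0 := lpow_ge0 w_gt0 p f.
rewrite seriesE; apply: le_trans (lpowD w_gt0 _ _ p1') _.
rewrite !lpowZ// normrN -/d -/e EFinM -muleA; apply: lee_wpmul2l.
  by rewrite lee_fin ltW.
have e0' : (0 <= e%:E)%E by rewrite lee_fin ltW.
rewrite EFinD ge0_muleDl//; apply: leeD => //; apply: lee_wpmul2l => //.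
apply: le_trans (rtlim_lpow p1 _ Ba lf) _; first by rewrite a0.
by rewrite -[leRHS]mul1e lee_wpmul2r// lee_fin.
Qed.

Lemma sqrt_series_bounded : bounded_operator w sqrt_series.
Proof.
split.
- exact: sqrt_series_l2.
- move=> a f g lf lg; apply/funext => x; rewrite /sqrt_series.
  rewrite (_ : (fun x => a * f x + g x) = (fun x => a * f x + 1 * g x)).
    by rewrite rtlim_lin//; ring.
  by apply/funext => y; rewrite mul1r.
- have [C C0 HC] := sqrt_series_lpow lt12.
  exists (C `^ 2^-1) => f lf; apply: poweR_leM => //.
  + exact: ltW.
  + exact: lpow_ge0.
  + exact: lpow_ge0.
  + exact: HC kk B_contr lf.
Qed.

Lemma sqrt_series_sq f : l2 w f -> sqrt_series (sqrt_series f) = T f.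
Proof.
move=> lf; have lY := rtlim_l2 lf; apply/funext => x.
rewrite TE// {1}/sqrt_series {2}seriesE rtlim_lin// /sqrt_series.
have e := rtlim_eq x lf.
have hc := sqr_sqrtr (ltW c_gt0); set r := Num.sqrt c in hc *; rewrite -hc.
have -> : B f x = 2 * rtlim f x - rtlim (rtlim f) x by rewrite [in RHS]e; field.
by ring.
Qed.

Lemma sqrt_series_sym f g : l2 w f -> l2 w g ->
  l2inner w (sqrt_series f) g = l2inner w f (sqrt_series g).
Proof.
move=> lf lg; rewrite !seriesE (l2innerC w f).
have [lYf lYg] := (rtlim_l2 lf, rtlim_l2 lg).
by rewrite !l2inner_lin// rtlim_sym// (l2innerC w f g) (l2innerC w f (rtlim g)).
Qed.

Lemma sqrt_series_coercive f : l2 w f ->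
  Num.sqrt c * ((1 - k) / 2) * l2inner w f f <= l2inner w (sqrt_series f) f.
Proof.
move=> lf; have lY := rtlim_l2 lf.
rewrite seriesE l2inner_lin//.
have := rtlim_coercive lf; rewrite l2innerB// => h.
have -> : Num.sqrt c * l2inner w f f + - Num.sqrt c * l2inner w (rtlim f) f =
    Num.sqrt c * (l2inner w f f - l2inner w (rtlim f) f) by ring.
by rewrite -mulrA ler_wpM2l// ltW.
Qed.

Lemma sqrt_series_nonnegative_sqrt : nonnegative_sqrt w T sqrt_series.
Proof.
split.
- exact: sqrt_series_bounded.
- by move=> f g lf lg; exact: sqrt_series_sym.
- move=> f lf; apply: le_trans (sqrt_series_coercive lf).
  have [k0 k1] := andP k01; apply: mulr_ge0; last exact: l2inner_ge0.
  by apply: mulr_ge0; [exact: ltW|lra].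
- by move=> f lf; rewrite sqrt_series_sq.
Qed.

(** A nonnegative square root S of T commutes with T, hence with B and with
    the limit S0.  For u = (S - S0) f this gives (S + S0) u = (S^2 - S0^2) f = 0,
    and S >= 0 together with the coercivity of S0 forces u = 0. *)
Lemma nonnegative_sqrt_unique S f : nonnegative_sqrt w T S -> l2 w f ->
  S f = sqrt_series f.
Proof.
move=> [Sb Ssym Spos Ssq] lf; have [Sl2 _ _] := Sb.
have S_lin a b g h := @bounded_operator_lin _ _ w w_gt0 S a b g h Sb.
have BE g : l2 w g -> B g = (fun x => 1 * g x + (- c^-1) * T g x).
  by move=> lg; apply/funext => x; rewrite TE//; field; rewrite gt_eqF.
have lT g : l2 w g -> l2 w (T g) by move=> lg; rewrite -Ssq//; do 2!apply: (Sl2).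
have SB g : l2 w g -> S (B g) = B (S g).
  move=> lg; have [l1 l2'] := (lT g lg, Sl2 g lg).
  rewrite BE// S_lin// [in RHS]BE//.
  by rewrite -Ssq// -(Ssq (S g)).
have lY := rtlim_l2 lf.
have comm : S (sqrt_series f) = sqrt_series (S f).
  apply/funext => x; rewrite seriesE S_lin// (rtlim_comm x Sb SB lf).
  by rewrite seriesE.
have S0b := sqrt_series_bounded.
have lS := Sl2 f lf; have lS0 := sqrt_series_l2 lf.
pose u x := 1 * S f x + (-1) * sqrt_series f x.
have lu : l2 w u by exact: l2_lin.
have hu x : S u x + sqrt_series u x = 0.
  rewrite /u S_lin// (bounded_operator_lin w_gt0 _ _ S0b)// comm Ssq//.
  by rewrite sqrt_series_sq//; ring.
have e : l2inner w (S u) u + l2inner w (sqrt_series u) u = 0.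
  have := l2inner_lin w_gt0 1 1 (Sl2 u lu) (sqrt_series_l2 lu) lu.
  have -> : (fun x => 1 * S u x + 1 * sqrt_series u x) =
      (fun x => 0 * u x + 0 * u x).
    by apply/funext => x; rewrite !mul1r hu; ring.
  by rewrite (l2inner_lin w_gt0 0 0 lu lu lu) !mul1r !mul0r addr0 => <-.
have u0 : l2inner w u u = 0.
  apply/eqP; rewrite eq_le l2inner_ge0// andbT.
  have [k0 k1] := andP k01.
  have d0 : 0 < Num.sqrt c * ((1 - k) / 2) by apply: mulr_gt0 => //; lra.
  rewrite -(pmulr_rle0 _ d0); apply: le_trans (sqrt_series_coercive lu) _.
  by have := Spos u lu; lra.
apply/funext => x; have := l2inner_point w_gt0 x lu; rewrite u0 pmulr_rle0// => ux.
have /eqP : u x ^+ 2 == 0 by rewrite eq_le ux sqr_ge0.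
by move/eqP; rewrite sqrf_eq0 /u => /eqP; lra.
Qed.

Lemma op_sqrtE f : l2 w f -> op_sqrt w T f = sqrt_series f.
Proof.
move=> lf; apply: nonnegative_sqrt_unique => //; rewrite /op_sqrt.
case: xgetP => // /(_ sqrt_series)[].
exact: sqrt_series_nonnegative_sqrt.
Qed.

End Operator.

End SquareRoot.

(** * The lazy random walk of a weighted graph *)

Section Graph.
Variables (R : realType) (V : choiceType) (G : weighted_graph R V).
Implicit Types (f g u v : V -> R) (x y : V).
Local Notation nu := (nu G).
Local Notation wt := (wt G).

Let nu_gt0 x : 0 < nu x. Proof. exact: nu_gt0. Qed.
Let nu_ge0 x : 0 <= nu x. Proof. exact: ltW. Qed.

Definition neighbours x : seq V := fset_set [set y | edge G [set x; y]].

Lemma mem_neighbours x y : (y \in neighbours x) = ([set x; y] \in edge G).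
Proof.
rewrite /neighbours in_fset_set; last exact: locally_finite.
by apply/idP/idP => /set_mem h; exact: mem_set.
Qed.

Lemma wt_ge0 x y : 0 <= wt x y.
Proof. by rewrite /Defs.wt; case: ifP => // /set_mem/mu_gt0 /ltW. Qed.

Lemma wtC x y : wt x y = wt y x.
Proof. by rewrite /Defs.wt setUC. Qed.

Lemma wt_notin x y : y \notin neighbours x -> wt x y = 0.
Proof. by rewrite mem_neighbours /Defs.wt => /negbTE ->. Qed.

Lemma fsum_neighbours x (h : V -> R) :
  (forall y, y \notin neighbours x -> h y = 0) ->
  \sum_(y \in [set: V]) h y = \sum_(y <- neighbours x) h y.
Proof. exact: fsbigTE. Qed.

Lemma esum_neighbours x (h : V -> R) : (forall y, 0 <= h y) ->
  (forall y, y \notin neighbours x -> h y = 0) ->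
  (\esum_(y in setT) (h y)%:E)%E = (\sum_(y <- neighbours x) h y)%:E.
Proof. by move=> h0 hr; apply: esum_fin_supp => //; exact: fset_uniq. Qed.

Lemma degE x : deg G x = \sum_(y <- neighbours x) wt x y.
Proof. by apply: fsum_neighbours => y; exact: wt_notin. Qed.

(** Each edge that is not a loop is counted twice. *)
Definition energy p f : \bar R :=
  (\esum_(x in setT) \esum_(y in setT) (wt x y * `|f x - f y| `^ p)%:E)%E.

Lemma energyE p f : energy p f = (\esum_(x in setT)
  (\sum_(y <- neighbours x) wt x y * `|f x - f y| `^ p)%:E)%E.
Proof.
apply: eq_esum => x _; apply: esum_neighbours => y.
  by rewrite mulr_ge0 ?wt_ge0 ?powR_ge0.
by move=> /wt_notin ->; rewrite mul0r.
Qed.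

Lemma energy_ge0 p f : (0 <= energy p f)%E.
Proof.
apply: esum_ge0 => x _; apply: esum_ge0 => y _.
by rewrite lee_fin mulr_ge0 ?wt_ge0 ?powR_ge0.
Qed.

Section LazyWalk.
Variable c : R.
Hypothesis c_gt0 : 0 < c.
Hypothesis deg_le : forall x, deg G x <= c / 2 * nu x.

Let b x y : R := wt x y / (c * nu x).

Let cnu_gt0 x : 0 < c * nu x. Proof. exact: mulr_gt0. Qed.

Let b_ge0 x y : 0 <= b x y.
Proof. by rewrite divr_ge0 ?wt_ge0 ?ltW. Qed.

Let b_sum x : \sum_(y <- neighbours x) b x y <= 2^-1.
Proof.
rewrite /b -mulr_suml -degE ler_pdivrMr//.
by apply: le_trans (deg_le x) _; rewrite mulrA [2^-1 * _]mulrC.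
Qed.

Let nu_b x y : nu x * b x y = c^-1 * wt x y.
Proof. by rewrite /b; field; rewrite !gt_eqF. Qed.

Let beta x := \sum_(y <- neighbours x) b x y.

(** The operator 1 - Delta / c.  The bound on the degrees makes it the transition
    operator of a random walk that stays put with probability at least 1/2. *)
Definition walk f : V -> R :=
  fun x => f x + \sum_(y <- neighbours x) b x y * (f y - f x).

Lemma walk_lin (r s : R) f g :
  walk (fun x => r * f x + s * g x) = (fun x => r * walk f x + s * walk g x).
Proof.
apply/funext => x; rewrite /walk.
rewrite (eq_bigr (fun y => r * (b x y * (f y - f x)) + s * (b x y * (g y - g x)))).
  by rewrite big_split/= -!mulr_sumr; ring.
by move=> y _; ring.
Qed.

Lemma laplacianE f x : laplacian G f x = c * (f x - walk f x).
Proof.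
rewrite /laplacian (@fsum_neighbours x); last first.
  by move=> y /wt_notin ->; rewrite mul0r.
rewrite /walk opprD addrA subrr sub0r mulrN -mulrN -sumrN !mulr_sumr.
by apply: eq_bigr => y _; rewrite /b; field; rewrite !gt_eqF.
Qed.

Lemma walkE f x : walk f x =
  (1 - beta x) * f x + \sum_(y <- neighbours x) b x y * f y.
Proof.
rewrite /walk (eq_bigr (fun y => b x y * f y - b x y * f x)).
  by rewrite sumrB -mulr_suml -/(beta x); ring.
by move=> y _; ring.
Qed.

Let beta_ge0 x : 0 <= beta x.
Proof. by rewrite sumr_ge0. Qed.

Let beta_le1 x : 0 <= 1 - beta x.
Proof. by have := b_sum x; rewrite -/(beta x); lra. Qed.

Lemma walk_ge0 u x : (forall y, 0 <= u y) -> 0 <= walk u x.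
Proof.
move=> u0; rewrite walkE addr_ge0 ?mulr_ge0//.
by apply: sumr_ge0 => y _; rewrite mulr_ge0.
Qed.

Lemma walk_jensen f x s : 1 <= s ->
  `|walk f x| `^ s <= walk (fun y => `|f y| `^ s) x.
Proof.
move=> s1.
pose r := None :: [seq Some y | y <- neighbours x].
pose p (o : option V) := if o is Some y then b x y else 1 - beta x.
pose h (o : option V) := if o is Some y then `|f y| else `|f x|.
have sumE (F : option V -> R) : \sum_(o <- r) p o * F o =
    (1 - beta x) * F None + \sum_(y <- neighbours x) b x y * F (Some y).
  by rewrite big_cons big_map.
have le1 : `|walk f x| <= \sum_(o <- r) p o * h o.
  rewrite sumE walkE; apply: le_trans (ler_normD _ _) _.
  rewrite normrM (ger0_norm (beta_le1 x)) lerD2l.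
  apply: le_trans (ler_norm_sum _ _ _) _.
  by apply: ler_sum => y _; rewrite normrM ger0_norm.
apply: (@le_trans _ _ ((\sum_(o <- r) p o * h o) `^ s)).
  apply: ge0_ler_powR; rewrite ?nnegrE//; first by lra.
  exact: le_trans (normr_ge0 _) le1.
apply: le_trans (jensen_powR _ _ _ _) _ => //.
- by case=> [y|]; rewrite /p.
- by case=> [y|]; rewrite /h.
- have := sumE (fun=> 1); under eq_bigr do rewrite mulr1.
  by move=> ->; under eq_bigr do rewrite mulr1; rewrite mulr1 -/(beta x) subrK.
by rewrite (sumE (fun o => h o `^ s)) walkE.
Qed.

(** Reversibility: nu x times the probability of a jump from x to y is
    mu_xy / c, which is symmetric. *)
Lemma walk_sym_ge0 u v : (forall x, 0 <= u x) -> (forall x, 0 <= v x) ->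
  (\esum_(x in setT) (nu x * walk u x * v x)%:E =
   \esum_(x in setT) (nu x * u x * walk v x)%:E)%E.
Proof.
move=> u0 v0.
pose Q (u v : V -> R) := (\esum_(x in setT) \esum_(y in setT)
  (c^-1 * wt x y * (u y * v x))%:E)%E.
have Q0 (u' v' : V -> R) : (forall x, 0 <= u' x) -> (forall x, 0 <= v' x) ->
    forall x y, 0 <= c^-1 * wt x y * (u' y * v' x).
  move=> u0' v0' x y; apply: mulr_ge0; last exact: mulr_ge0.
  by rewrite mulr_ge0 ?wt_ge0// invr_ge0 ltW.
have walkQ (u' v' : V -> R) : (forall x, 0 <= u' x) -> (forall x, 0 <= v' x) ->
    (\esum_(x in setT) (nu x * walk u' x * v' x)%:E =
    \esum_(x in setT) (nu x * (1 - beta x) * (u' x * v' x))%:E + Q u' v')%E.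
  move=> u0' v0'; rewrite -esumD; first last.
  - by move=> x _; apply: esum_ge0 => y _; rewrite lee_fin Q0.
  - by move=> x _; rewrite lee_fin !mulr_ge0.
  apply: eq_esum => x _; rewrite (@esum_neighbours x); first last.
  - by move=> y /wt_notin ->; rewrite mulr0 mul0r.
  - by move=> y; exact: Q0.
  rewrite -EFinD walkE; congr EFin; rewrite mulrDr mulrDl; congr (_ + _).
    by ring.
  rewrite mulr_sumr mulr_suml; apply: eq_bigr => y _.
  by rewrite -nu_b; ring.
rewrite walkQ//.
have -> : (\esum_(x in setT) (nu x * u x * walk v x)%:E =
           \esum_(x in setT) (nu x * walk v x * u x)%:E)%E.
  by apply: eq_esum => x _; rewrite mulrAC.
rewrite walkQ//; congr (_ + _)%E.
  by apply: eq_esum => x _; rewrite (mulrC (u x)).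
rewrite /Q exchange_esum; last by move=> x y; rewrite lee_fin Q0.
by apply: eq_esum => x _; apply: eq_esum => y _; rewrite wtC (mulrC (u _)).
Qed.

(** A reversible walk that fixes the constants leaves nu invariant. *)
Lemma walk_mass u : (forall x, 0 <= u x) ->
  (\esum_(x in setT) (nu x * walk u x)%:E = \esum_(x in setT) (nu x * u x)%:E)%E.
Proof.
move=> u0; have := @walk_sym_ge0 u (fun=> 1) u0 (fun=> ler01).
have w1 x : walk (fun=> 1) x = 1.
  by rewrite /walk big1 ?addr0// => y _; rewrite subrr mulr0.
under eq_esum do rewrite mulr1; move=> ->.
by apply: eq_esum => x _; rewrite w1 mulr1.
Qed.

Lemma walk_lpow p f : 1 <= p -> (lpow nu p (walk f) <= lpow nu p f)%E.
Proof.
move=> p1; rewrite /lpow -(@walk_mass (fun x => `|f x| `^ p))//.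
by apply: le_esum => x _; rewrite lee_fin ler_wpM2l// walk_jensen.
Qed.

(** Laziness makes the variance of one step dominate the energy.  Let d be the
    increment of f along a jump, m and S the sums of b d and b d^2 over the jumps.
    As the jumps have total probability at most 1/2, summing b (d - 2 m)^2 >= 0
    gives S - 4 m^2 + 2 m^2 >= 0, so that m^2 <= S / 2. *)
Lemma walk_variance f x :
  walk f x ^+ 2 + 2^-1 * \sum_(y <- neighbours x) b x y * (f x - f y) ^+ 2
  <= walk (fun y => f y ^+ 2) x.
Proof.
pose m := \sum_(y <- neighbours x) b x y * (f y - f x).
pose S := \sum_(y <- neighbours x) b x y * (f x - f y) ^+ 2.
have h : 0 <= \sum_(y <- neighbours x) b x y * (f y - f x - 2 * m) ^+ 2.
  by apply: sumr_ge0 => y _; rewrite mulr_ge0 ?sqr_ge0.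
rewrite (eq_bigr (fun y => b x y * (f x - f y) ^+ 2 +
   ((- 4 * m) * (b x y * (f y - f x)) + (4 * m ^+ 2) * b x y))) in h; last first.
  by move=> y _; ring.
rewrite !big_split/= -!mulr_sumr -/S -/m -/(beta x) in h.
have e : walk (fun y => f y ^+ 2) x = f x ^+ 2 + 2 * f x * m + S.
  rewrite /walk -addrA; congr (_ + _).
  rewrite (eq_bigr (fun y => (2 * f x) * (b x y * (f y - f x)) +
    b x y * (f x - f y) ^+ 2)); last by move=> y _; ring.
  by rewrite big_split/= -mulr_sumr.
rewrite e -/S /walk -/m.
have hb := b_sum x; rewrite -/(beta x) in hb.
have hm : 0 <= 4 * m ^+ 2 * (2^-1 - beta x).
  by apply: mulr_ge0; [rewrite mulr_ge0 ?sqr_ge0|lra].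
rewrite -subr_ge0 (_ : _ - _ = 2^-1 * (S + (- 4 * m * m + 4 * m ^+ 2 * beta x))
   + 2^-1 * (4 * m ^+ 2 * (2^-1 - beta x))); last by field.
by rewrite addr_ge0// mulr_ge0.
Qed.

Lemma walk_energy f :
  (lpow nu 2 (walk f) + (2^-1 * c^-1)%:E * energy 2 f <= lpow nu 2 f)%E.
Proof.
rewrite !lpow2E -(@walk_mass (fun x => f x ^+ 2))//; last by move=> x; exact: sqr_ge0.
have E0 x : 0 <= \sum_(y <- neighbours x) wt x y * `|f x - f y| `^ 2.
  by apply: sumr_ge0 => y _; rewrite mulr_ge0 ?wt_ge0 ?powR_ge0.
have c0 : 0 <= 2^-1 * c^-1 by rewrite mulr_ge0// invr_ge0 ltW.
rewrite energyE -esumZ//.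
rewrite -esumD; first last.
- by move=> x _; rewrite -EFinM lee_fin mulr_ge0.
- by move=> x _; rewrite lee_fin mulr_ge0 ?sqr_ge0.
apply: le_esum => x _; rewrite -EFinM -EFinD lee_fin.
apply: le_trans (ler_wpM2l (nu_ge0 x) (walk_variance f x)).
rewrite mulrDr lerD2l -mulrA (mulrCA (nu x)) ler_wpM2l// !mulr_sumr.
apply: ler_sum => y _; rewrite powR_norm2 mulrA (mulrA (nu x)).
by rewrite nu_b.
Qed.

(** Jensen's inequality for the jumps from each vertex. *)
Lemma laplacian_lpow p f : 1 <= p ->
  (lpow nu p (laplacian G f) <= (c `^ p / c)%:E * energy p f)%E.
Proof.
move=> p1; have cp : 0 <= c `^ p / c by rewrite divr_ge0 ?powR_ge0 ?ltW.
rewrite energyE -esumZ//; last first.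
  move=> x; rewrite lee_fin; apply: sumr_ge0 => y _.
  by rewrite mulr_ge0 ?wt_ge0 ?powR_ge0.
apply: le_esum => x _; rewrite -EFinM lee_fin.
have le1 : `|laplacian G f x| <= c * \sum_(y <- neighbours x) b x y * `|f x - f y|.
  rewrite laplacianE normrM gtr0_norm// ler_pM2l// /walk opprD addrA subrr sub0r.
  rewrite normrN; apply: le_trans (ler_norm_sum _ _ _) _.
  by apply: ler_sum => y _; rewrite normrM ger0_norm// distrC.
have S0 : 0 <= \sum_(y <- neighbours x) b x y * `|f x - f y|.
  by apply: sumr_ge0 => y _; rewrite mulr_ge0.
apply: (@le_trans _ _ (nu x * (c `^ p *
    \sum_(y <- neighbours x) b x y * `|f x - f y| `^ p))).
  rewrite ler_wpM2l//.
  apply: (@le_trans _ _ ((c * \sum_(y <- neighbours x) b x y * `|f x - f y|) `^ p)).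
    by apply: ge0_ler_powR; rewrite ?nnegrE ?mulr_ge0 ?(ltW c_gt0)//; lra.
  rewrite powRM ?(ltW c_gt0)// ler_wpM2l ?powR_ge0//.
  by apply: jensen_powR => //; have := b_sum x; lra.
rewrite mulrCA -mulrA ler_wpM2l ?powR_ge0// !mulr_sumr.
by apply: ler_sum => y _; rewrite mulrA nu_b mulrA.
Qed.

Lemma energy_lpow p f : 1 <= p ->
  (energy p f <= (2^-1 `^ (1 - p) * c)%:E * lpow nu p f)%E.
Proof.
move=> p1; pose d := 2^-1 `^ (1 - p) : R.
have d0 : 0 <= d by exact: powR_ge0.
pose A := (\esum_(x in setT) \esum_(y in setT) (wt x y * `|f x| `^ p)%:E)%E.
have a0 x y : 0 <= wt x y * `|f x| `^ p by rewrite mulr_ge0 ?wt_ge0 ?powR_ge0.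
have a0' x y : 0 <= wt x y * `|f y| `^ p by rewrite mulr_ge0 ?wt_ge0 ?powR_ge0.
have A0 : (0 <= A)%E.
  by apply: esum_ge0 => x _; apply: esum_ge0 => y _; rewrite lee_fin.
have AE : (A <= (c / 2)%:E * lpow nu p f)%E.
  rewrite /lpow -esumZ; first last.
  - by move=> x; rewrite lee_fin mulr_ge0 ?powR_ge0.
  - by rewrite divr_ge0 ?ltW.
  apply: le_esum => x _; rewrite (@esum_neighbours x)//; last first.
    by move=> y /wt_notin ->; rewrite mul0r.
  by rewrite -EFinM lee_fin -mulr_suml -degE mulrA ler_wpM2r ?powR_ge0.
have AC : A = (\esum_(x in setT) \esum_(y in setT) (wt x y * `|f y| `^ p)%:E)%E.
  rewrite /A exchange_esum; last by move=> x y; rewrite lee_fin.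
  by apply: eq_esum => x _; apply: eq_esum => y _; rewrite wtC.
have : (energy p f <= d%:E * (A + A))%E.
  rewrite {2}AC /A -esumD; first last.
  - by move=> x _; apply: esum_ge0 => y _; rewrite lee_fin.
  - by move=> x _; apply: esum_ge0 => y _; rewrite lee_fin.
  rewrite -esumZ//; last first.
    by move=> x; apply: adde_ge0; apply: esum_ge0 => y _; rewrite lee_fin.
  apply: le_esum => x _.
  rewrite -esumD; try by move=> y _; rewrite lee_fin.
  rewrite -esumZ//; last by move=> y; rewrite adde_ge0 ?lee_fin.
  apply: le_esum => y _; rewrite -EFinD -EFinM lee_fin -mulrDr mulrCA.
  rewrite ler_wpM2l ?wt_ge0//.
  apply: (@le_trans _ _ ((`|f x| + `|f y|) `^ p)).
    by rewrite ge0_ler_powR ?nnegrE ?addr_ge0 ?ler_normB//; lra.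
  have h : 0 < (2^-1 : R) < 1 by lra.
  have := powRD_convex p1 h (normr_ge0 (f x)) (normr_ge0 (f y)).
  by rewrite (_ : 1 - 2^-1 = 2^-1 :> R) -?mulrDr//; lra.
move/le_trans; apply; rewrite EFinM -muleA; apply: lee_wpmul2l.
  by rewrite lee_fin.
apply: le_trans (leeD AE AE) _.
have c2 : (0 <= (c / 2)%:E)%E by rewrite lee_fin divr_ge0// ltW.
have -> : c%:E = ((c / 2)%:E + (c / 2)%:E)%E by rewrite -EFinD; congr EFin; field.
by rewrite ge0_muleDl.
Qed.

End LazyWalk.
End Graph.

(** * From the spectral gap to strict contraction *)

Section SpectralGap.
Variables (R : realType) (V : choiceType) (G : weighted_graph R V).
Variable c : R.
Hypothesis c_gt0 : 0 < c.
Hypothesis deg_le : forall x, deg G x <= c / 2 * nu G x.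
Implicit Types (f g u v : V -> R) (x y : V).
Local Notation nu := (nu G).
Local Notation walk := (walk G c).

Let nu_gt0 x : 0 < nu x. Proof. exact: nu_gt0. Qed.
Let nu_ge0 x : 0 <= nu x. Proof. exact: ltW. Qed.

Lemma walk_l2 f : l2 nu f -> l2 nu (walk f).
Proof.
move=> /l2P lf; apply/l2P; apply: le_lt_trans lf.
by apply: walk_lpow => //; lra.
Qed.

(** The nonnegative case is reversibility; the general one follows by splitting
    both functions into positive and negative parts. *)
Lemma walk_sym f g : l2 nu f -> l2 nu g ->
  l2inner nu (walk f) g = l2inner nu f (walk g).
Proof.
move=> lf lg.
have sym0 u v : (forall x, 0 <= u x) -> (forall x, 0 <= v x) ->
    l2inner nu (walk u) v = l2inner nu u (walk v).
  move=> u0 v0; have wu0 x := @walk_ge0 _ _ _ _ c_gt0 deg_le u x u0.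
  have wv0 x := @walk_ge0 _ _ _ _ c_gt0 deg_le v x v0.
  rewrite /l2inner -!/(ssum _) !ge0_ssum; try by move=> x; rewrite !mulr_ge0.
  by rewrite walk_sym_ge0.
have pnE (h : V -> R) : h = (fun x => 1 * h^\+ x + (-1) * h^\- x).
  by apply/funext => x; rewrite -[in LHS](funrposBneg h) mul1r mulN1r.
have lpos h : l2 nu h -> l2 nu h^\+.
  move=> /l2P lh; apply/l2P; apply: le_lt_trans lh.
  apply: le_lpow => // x; rewrite ger0_norm ?funrpos_ge0// /funrpos.
  by rewrite ge_max normr_ge0 ler_norm.
have lneg h : l2 nu h -> l2 nu h^\-.
  move=> /l2P lh; apply/l2P; apply: le_lt_trans lh.
  apply: le_lpow => // x; rewrite ger0_norm ?funrneg_ge0// /funrneg.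
  by rewrite ge_max normr_ge0 -normrN ler_norm.
have [pf nf] := (lpos f lf, lneg f lf).
have [pg ng] := (lpos g lg, lneg g lg).
have [wpf wnf] := (walk_l2 pf, walk_l2 nf).
have [wpg wng] := (walk_l2 pg, walk_l2 ng).
rewrite (pnE f) walk_lin (l2inner_lin nu_gt0 1 (-1) wpf wnf lg).
rewrite [RHS](l2inner_lin nu_gt0 1 (-1) pf nf (walk_l2 lg)).
rewrite (pnE g) walk_lin.
rewrite !(l2innerC _ _ (fun x => 1 * g^\+ x + _)).
rewrite !(l2innerC _ _ (fun x => 1 * walk g^\+ x + _)) !l2inner_lin//.
have [f0 f1] := (@funrpos_ge0 _ _ f, @funrneg_ge0 _ _ f).
have [g0 g1] := (@funrpos_ge0 _ _ g, @funrneg_ge0 _ _ g).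
by rewrite !(sym0 g^\+)// !(sym0 g^\-).
Qed.

(** If Delta has a bounded inverse, then N_2(f) <= C N_2(Delta f) <= D E(f) where E
    is the energy, and N_2(P f) <= N_2(f) - e E(f) with e = 1 / (2 c) becomes a
    strict contraction. *)
Lemma walk_gap2 : resolvent_set nu (laplacian G) 0 ->
  exists2 k : R, 0 < k < 1 &
    forall f, (lpow nu 2 (walk f) <= k%:E * lpow nu 2 f)%E.
Proof.
move=> [S [Sb SK]]; have [C C0 HC] := bounded_operator_lpow nu_gt0 Sb.
have le12 : 1 <= (2 : R) by lra.
pose D := C * (c `^ 2 / c).
have D0 : 0 < D by rewrite mulr_gt0// divr_gt0// powR_gt0.
pose e := 2^-1 * c^-1.
have e0 : 0 < e by rewrite mulr_gt0// invr_gt0.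
have De0 : 0 < D + e by exact: addr_gt0.
exists (D / (D + e)).
  by rewrite divr_gt0//= ltr_pdivrMr// mul1r ltrDl.
move=> f; have [lf|] := pselect (l2 nu f); last first.
  move/l2P/negP; rewrite ltey negbK => /eqP ->.
  by rewrite gt0_muley ?leey// lte_fin divr_gt0.
have := @walk_energy _ _ _ c c_gt0 deg_le f.
have := energy_lpow c_gt0 deg_le f le12.
have := laplacian_lpow c_gt0 deg_le f le12.
have : (lpow nu 2 (laplacian G f) < +oo)%E ->
    (lpow nu 2 f <= C%:E * lpow nu 2 (laplacian G f))%E.
  move=> /l2P lDf; have [e1 _] := SK f lf.
  rewrite -[in leLHS]e1 (_ : minus_scalar _ _ _ = laplacian G f); first exact: HC.
  by apply/funext => x; rewrite /minus_scalar mul0r subr0.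
have := lpow_ge0 nu_gt0 2 (laplacian G f); have := lpow_ge0 nu_gt0 2 (walk f).
have := energy_ge0 G 2 f.
rewrite -(l2inner_self nu_gt0 lf) -(l2inner_self nu_gt0 (walk_l2 lf)) -/e.
case: (energy G 2 f) => [E| |]; first last.
- by rewrite leeNy_eq.
- by move=> _ _ _ _ _ + _; rewrite -EFinM leye_eq.
case: (lpow nu 2 (laplacian G f)) => [L| |]; first last.
- by rewrite leeNy_eq.
- by move=> _ _ _ _ + _ _; rewrite -EFinM leye_eq.
move=> E0 W0 L0 /(_ (ltry _)); rewrite -!EFinM -EFinD !lee_fin => h1 h2 _ h3.
have h4 : l2inner nu f f <= D * E.
  by apply: le_trans h1 _; rewrite -mulrA ler_pM2l.
rewrite mulrAC ler_pdivlMr// mulrDr.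
set W := l2inner nu (walk f) _ in W0 h3 *; set F := l2inner nu f f in h1 h3 h4 *.
have h5 : e * F <= e * (D * E) by rewrite ler_pM2l.
have h6 : W * D <= (F - e * E) * D by rewrite ler_pM2r//; lra.
have h7 : W * e <= F * e.
  have eE0 : 0 <= e * E by apply: mulr_ge0 => //; exact: ltW.
  by rewrite ler_pM2r//; lra.
apply: (le_trans (lerD h6 h7)); rewrite -subr_ge0.
by move: h5; rewrite -subr_ge0; congr (0 <= _); ring.
Qed.

End SpectralGap.

Section Interpolation.
Variables (R : realType) (V : choiceType) (G : weighted_graph R V).
Variable c : R.
Hypothesis c_gt0 : 0 < c.
Hypothesis deg_le : forall x, deg G x <= c / 2 * nu G x.
Implicit Types (f g u v : V -> R) (x y : V).
Local Notation nu := (nu G).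
Local Notation walk := (walk G c).

Let nu_gt0 x : 0 < nu x. Proof. exact: nu_gt0. Qed.
Let nu_ge0 x : 0 <= nu x. Proof. exact: ltW. Qed.

Variable k : R.
Hypothesis k01 : 0 < k < 1.
Hypothesis gap2 : forall f, (lpow nu 2 (walk f) <= k%:E * lpow nu 2 f)%E.

(** Jensen's inequality for |f|^(p / 2) reduces the exponent p to 2. *)
Lemma walk_gap_ge2 p f : 2 <= p -> (lpow nu p (walk f) <= k%:E * lpow nu p f)%E.
Proof.
move=> p2; pose g x := `|f x| `^ (p / 2).
have gE (a : R) : `| `|a| `^ (p / 2)| `^ 2 = `|a| `^ p.
  by rewrite ger0_norm ?powR_ge0// -powRrM divfK.
have -> : lpow nu p f = lpow nu 2 g by apply: eq_esum => x _; rewrite gE.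
apply: le_trans (gap2 g); apply: le_esum => x _; rewrite lee_fin ler_wpM2l//.
rewrite -gE//; apply: ge0_ler_powR; rewrite ?nnegrE//.
rewrite ger0_norm ?powR_ge0// (le_trans (walk_jensen c_gt0 deg_le f x _))//.
  by rewrite ler_pdivlMr ?mul1r.
exact: ler_norm.
Qed.

(** Write N_p for the power sums and P for the walk.
    For p < 2 the estimate follows by duality from the conjugate exponent q.
    With u = |f| and h = (P u)^(p - 1),
      N_p(P u) = <P u, h> = <u, P h>,
    and Young's inequality, weighted so that the gap at q cancels the weight,
    bounds this by k^(p / q) N_p(u) / p + N_p(P u) / q. *)
Lemma walk_gap_lt2 p f : 1 < p < 2 ->
  (lpow nu p (walk f) <= ((k `^ ((p - 1) / p)) `^ p)%:E * lpow nu p f)%E.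
Proof.
move=> /andP[p1 p2]; have [k0 k1] := andP k01.
have p0 : 0 < p by lra.
have pN0 : p != 0 by rewrite gt_eqF.
have p1N0 : p - 1 != 0 by rewrite gt_eqF//; lra.
pose q := p / (p - 1).
have q2 : 2 <= q by rewrite /q ler_pdivlMr; lra.
have q0 : 0 < q by lra.
have pq : p^-1 + q^-1 = 1 by rewrite /q invf_div; field.
have qV : (p - 1) / p = q^-1 by rewrite /q invf_div.
rewrite qV; set th := k `^ q^-1.
have th0 : 0 < th by rewrite powR_gt0.
have thq : th `^ q = k by rewrite -powRrM mulVf ?gt_eqF// powRr1 ?ltW.
pose u x := `|f x|; have u0 x : 0 <= u x by exact: normr_ge0.
have wu0 x : 0 <= walk u x by exact: walk_ge0.
pose h x := walk u x `^ (p - 1); have h0 x : 0 <= h x by exact: powR_ge0.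
have wh0 x : 0 <= walk h x by exact: walk_ge0.
have uE : lpow nu p u = lpow nu p f by apply: eq_esum => x _; rewrite normr_id.
have le1 : (lpow nu p (walk f) <= lpow nu p (walk u))%E.
  apply: le_lpow => //; first exact: ltW.
  move=> x; have := walk_jensen c_gt0 deg_le f x (lexx 1).
  rewrite powRr1// (_ : (fun y => `|f y| `^ 1) = u).
    by move/le_trans; apply; exact: ler_norm.
  by apply/funext => y; rewrite powRr1.
apply: le_trans le1 _; rewrite -uE.
set A := lpow nu p (walk u); set U := lpow nu p u.
have AU : (A <= U)%E by apply: walk_lpow => //; exact: ltW.
have U0 : (0 <= U)%E by exact: lpow_ge0.
have A0 : (0 <= A)%E by exact: lpow_ge0.
have hA : lpow nu q h = A.
  apply: eq_esum => x _; rewrite ger0_norm// /h -powRrM ger0_norm//.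
  by rewrite (_ : (p - 1) * q = p)// /q; field.
have AE : A = (\esum_(x in setT) (nu x * u x * walk h x)%:E)%E.
  rewrite -walk_sym_ge0//; apply: eq_esum => x _.
  by rewrite ger0_norm// -mulrA mulr_powRB1.
have tp0 : 0 <= th `^ p / p by rewrite divr_ge0 ?powR_ge0 ?ltW.
have kq0 : 0 <= k^-1 / q by rewrite divr_ge0 ?invr_ge0 ?ltW.
have young : (A <= (th `^ p / p)%:E * U + (k^-1 / q)%:E * lpow nu q (walk h))%E.
  rewrite {1}AE /U /lpow -!esumZ//;
    try by move=> x; rewrite lee_fin mulr_ge0 ?powR_ge0.
  rewrite -esumD; try by move=> x _; rewrite -EFinM lee_fin !mulr_ge0
    ?powR_ge0 ?invr_ge0 ?ltW.
  apply: le_esum => x _; rewrite -!EFinM -EFinD lee_fin.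
  rewrite !ger0_norm// mulrCA (mulrCA _ (nu x)) -mulrDr -mulrA ler_wpM2l//.
  have thu0 : 0 <= th * u x by rewrite mulr_ge0// ltW.
  have thw0 : 0 <= walk h x / th by rewrite divr_ge0// ltW.
  have := @conjugate_powR _ (th * u x) (walk h x / th) p q thu0 thw0 p0 q0 pq.
  rewrite (_ : th * u x * (walk h x / th) = u x * walk h x); last first.
    by field; rewrite gt_eqF.
  move/le_trans; apply; rewrite powRM ?(ltW th0)// powRM ?invr_ge0 ?(ltW th0)//.
  rewrite -(powR_inv1 (ltW th0)) -powRrM mulN1r powRN thq.
  by rewrite le_eqVlt; apply/orP; left; apply/eqP; field; rewrite !gt_eqF.
have {young} : (A <= (th `^ p / p)%:E * U + (q^-1)%:E * A)%E.
  apply: le_trans young _; rewrite leeD2l//.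
  have kq0' : (0 <= (k^-1 / q)%:E)%E by rewrite lee_fin.
  apply: le_trans (lee_wpmul2l kq0' (walk_gap_ge2 h q2)) _.
  by rewrite hA muleA -EFinM (_ : k^-1 / q * k = q^-1)//; field; rewrite !gt_eqF.
have thp : 0 < th `^ p by exact: powR_gt0.
move: AU U0 A0; case: U => [U| |]; first last.
- by rewrite leeNy_eq => /eqP ->.
- by move=> *; rewrite gt0_muley ?leey// lte_fin.
case: A {hA AE} => [A| |]; first last.
- by rewrite [in X in _ -> X]leeNy_eq.
- by rewrite leye_eq.
move=> _ _ _; rewrite -!EFinM -EFinD !lee_fin => hh.
rewrite -subr_ge0 (_ : _ - _ = p * (th `^ p / p * U + q^-1 * A - A)).
  by apply: mulr_ge0; rewrite ?subr_ge0// ltW.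
by rewrite (_ : q^-1 = 1 - p^-1); [field|lra].
Qed.

Lemma walk_gap p : 1 < p -> exists2 a : R, 0 < a < 1 &
  forall f, (lpow nu p (walk f) <= a%:E * lpow nu p f)%E.
Proof.
move=> p1; have [k0 k1] := andP k01; have [p2|p2] := leP 2 p.
  by exists k => // f; exact: walk_gap_ge2.
exists ((k `^ ((p - 1) / p)) `^ p); last first.
  by move=> f; apply: walk_gap_lt2; rewrite p1.
rewrite !powR_gt0//= -powRrM divfK; last by rewrite gt_eqF//; lra.
have := @gt0_ltr_powR _ (p - 1) _ k 1; rewrite powR1; apply=> //.
- by lra.
- by rewrite nnegrE ltW.
- by rewrite nnegrE.
Qed.

End Interpolation.

(** * Norms over edges and the norm of the gradient *)

Section Edges.
Variables (R : realType) (V : choiceType) (G : weighted_graph R V).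
Implicit Types (f : V -> R) (p : R) (e : set V).

Definition edge_power p f : \bar R :=
  (\esum_(e in edge G) (mu G e * `|edge_diff f e| `^ p)%:E)%E.

Let orientations e : set (V * V) := [set xy | [set xy.1; xy.2] = e].

(** Sorting ordered pairs by the edge that they span; pairs that span no edge have
    weight zero. *)
Lemma energy_edges p f : energy G p f = (\esum_(e in edge G)
  \esum_(xy in orientations e) (mu G e * `|edge_diff f e| `^ p)%:E)%E.
Proof.
have F0 e : edge G e -> 0 <= mu G e * `|edge_diff f e| `^ p.
  by move=> /mu_gt0 e0; rewrite mulr_ge0 ?powR_ge0 ?ltW.
rewrite /energy esum_esum; last first.
  by move=> x y _ _; rewrite lee_fin mulr_ge0 ?wt_ge0 ?powR_ge0.
rewrite (esumID [set xy : V * V | edge G [set xy.1; xy.2]]); last first.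
  by move=> xy _; rewrite lee_fin mulr_ge0 ?wt_ge0 ?powR_ge0.
rewrite [X in (_ + X)%E]esum1 ?adde0; last first.
  move=> [x y] [_ /= ne]; rewrite /Defs.wt.
  by rewrite (_ : _ \in _ = false) ?mul0r//; apply/negP => /set_mem.
rewrite esum_esum; last first.
  by move=> e xy /F0 e0 _; rewrite lee_fin.
rewrite (reindex_esum
  ((setT `*`` fun=> setT) `&` [set xy : V * V | edge G [set xy.1; xy.2]])
  _ (fun xy => ([set xy.1; xy.2], xy))).
  apply: eq_esum => -[x y] [_ /= Exy].
  by rewrite edge_diffE normr_id /Defs.wt ifT//; exact: mem_set.
split.
- by move=> [x y] [_ /= Exy]; split.
- by move=> [x y] [x' y'] _ _ /= [_ -> ->].
- by move=> [e [x y]] /= [Ee exy]; exists (x, y); rewrite /= ?exy.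
Qed.

Lemma edge_power_le_energy p f : (edge_power p f <= energy G p f)%E.
Proof.
rewrite energy_edges; apply: le_esum => e Ee.
have [x [y exy]] := edge_pair Ee.
have F0 : (0 <= (mu G e * `|edge_diff f e| `^ p)%:E)%E.
  by rewrite lee_fin mulr_ge0 ?powR_ge0// ltW// mu_gt0.
apply: esum_ge; exists [set (x, y)]; last by rewrite fsbig_set1.
by split; [exact: finite_set1|move=> _ ->; rewrite /orientations/= exy].
Qed.

(** An edge has at most two orientations. *)
Lemma energy_le_edge_power p f : (energy G p f <= 2%:E * edge_power p f)%E.
Proof.
have F0 e : edge G e -> (0 <= (mu G e * `|edge_diff f e| `^ p)%:E)%E.
  by move=> /mu_gt0 e0; rewrite lee_fin mulr_ge0 ?powR_ge0 ?ltW.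
have -> : (2%:E * edge_power p f = edge_power p f + edge_power p f)%E.
  have E0 : (0 <= edge_power p f)%E by exact: esum_ge0.
  by rewrite (_ : 2%:E = 1 + 1 :> \bar R)%E ?ge0_muleDl ?mul1e// -EFinD.
rewrite energy_edges /edge_power -esumD//; apply: le_esum => e Ee.
have [x [y exy]] := edge_pair Ee; set F := (_%:E)%E in F0 *.
have {}F0 : (0 <= F)%E by exact: F0.
have sub : orientations e `<=` [set (x, y)] `|` [set (y, x)].
  move=> [u v] /=; rewrite /orientations/= exy => uv.
  have xu : [set x; y] u by rewrite -uv; left.
  have xv : [set x; y] v by rewrite -uv; right.
  have ux : [set u; v] x by rewrite uv; left.
  have uy : [set u; v] y by rewrite uv; right.
  case: xu => /= xu; case: xv => /= xv; rewrite {uv} xu xv in ux uy *.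
  - by case: uy => ->; left.
  - by left.
  - by right.
  - by case: ux => ->; right.
have le1 (D : set (V * V)) k : D `<=` [set k] -> (\esum_(i in D) F <= F)%E.
  move=> Dk; rewrite -[leRHS](@esum_set1 _ _ k (fun=> F))//.
  rewrite esum_mkcond [leRHS]esum_mkcond; apply: le_esum => i _.
  case: ifPn => [/set_mem/Dk ki|_]; first by rewrite ifT//; exact: mem_set.
  by case: ifP.
rewrite (esumID [set (x, y)])//; apply: leeD;
  [apply: (le1 _ (x, y))|apply: (le1 _ (y, x))].
- by move=> i [].
- by move=> i [/sub[]].
Qed.

End Edges.

Section NormComparison.
Variables (R : realType) (I : Type) (A : set I).
Implicit Types F H : I -> \bar R.

Lemma equivalent_on_bounds F H (a b : R) : 0 < a -> 0 < b ->
  (forall f, A f -> (F f <= a%:E * H f)%E) ->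
  (forall f, A f -> (H f <= b%:E * F f)%E) -> equivalent_on A F H.
Proof.
move=> a0 b0 FH HF; exists b^-1, a; split => //; first by rewrite invr_gt0.
move=> f Af; split; last exact: FH.
have h : (0 <= b^-1%:E)%E by rewrite lee_fin invr_ge0 ltW.
apply: (le_trans (lee_wpmul2l h (HF f Af))).
by rewrite muleA -EFinM mulVf ?gt_eqF// mul1e.
Qed.

End NormComparison.

Section Gradient.
Variables (R : realType) (V : choiceType) (G : weighted_graph R V).
Variable c : R.
Hypothesis c_gt0 : 0 < c.
Hypothesis deg_le : forall x, deg G x <= c / 2 * nu G x.

(** The variance estimate bounds |grad f|^2 pointwise by c P(f^2), and P is a
    contraction of l^(p / 2). *)
Lemma gradient_lpow p f : 2 <= p ->
  (lpow (nu G) p (gradient G f) <= (c `^ (p / 2))%:E * lpow (nu G) p f)%E.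
Proof.
move=> p2; have n0 x : 0 < nu G x by exact: nu_gt0.
have p21 : 1 <= p / 2 by rewrite ler_pdivlMr ?mul1r.
have w0 x : 0 <= walk G c (fun y => f y ^+ 2) x.
  by apply: walk_ge0 => // y; exact: sqr_ge0.
have gle x : gradient G f x ^+ 2 <= c * walk G c (fun y => f y ^+ 2) x.
  rewrite /gradient (@fsum_neighbours _ _ G x); last first.
    by move=> y /wt_notin ->; rewrite mulr0.
  rewrite sqr_sqrtr; last first.
    apply: mulr_ge0; first by rewrite invr_ge0 mulr_ge0// ltW.
    by apply: sumr_ge0 => y _; rewrite mulr_ge0 ?wt_ge0 ?sqr_ge0.
  have := walk_variance c_gt0 deg_le f x.
  set S := (X in 2^-1 * X) => hS.
  rewrite [leLHS](_ : _ = c * (2^-1 * S)).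
    by rewrite ler_pM2l//; apply: le_trans hS; rewrite lerDr sqr_ge0.
  rewrite /S !mulr_sumr; apply: eq_bigr => y _.
  by rewrite real_normK ?num_real//; field; rewrite !gt_eqF.
have powE (a : R) : (a ^+ 2) `^ (p / 2) = `|a| `^ p.
  by rewrite -powR_norm2 -powRrM mulrCA divff ?mulr1.
have p0 : 0 <= p / 2 by lra.
apply: (@le_trans _ _ ((c `^ (p / 2))%:E *
    \esum_(x in setT) (nu G x * walk G c (fun y => `|f y| `^ p) x)%:E)%E).
  rewrite -esumZ ?powR_ge0//; last first.
    move=> x; rewrite lee_fin; apply: mulr_ge0; first exact: ltW.
    by apply: walk_ge0 => // y; exact: powR_ge0.
  apply: le_esum => x _; rewrite -EFinM lee_fin mulrCA ler_wpM2l ?(ltW (n0 x))//.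
  rewrite -powE; apply: (@le_trans _ _
    ((c * walk G c (fun y => f y ^+ 2) x) `^ (p / 2))).
    by apply: ge0_ler_powR; rewrite ?nnegrE ?sqr_ge0// mulr_ge0// ltW.
  rewrite powRM ?(ltW c_gt0)// ler_wpM2l ?powR_ge0//.
  have := walk_jensen c_gt0 deg_le (fun y => f y ^+ 2) x p21.
  rewrite ger0_norm//; congr (_ <= walk G c _ x).
  by apply/funext => y; rewrite ger0_norm ?sqr_ge0.
by rewrite walk_mass// => x; exact: powR_ge0.
Qed.

End Gradient.

(** * Comparison of the norms *)

Theorem theorem1p3 (R : realType) (V : choiceType) (G : weighted_graph R V)
  (hM : (ereal_sup (range (fun x : V => (deg G x / nu G x)%:E)) < +oo)%E)
  (hgap : (0 < ereal_inf (EFin @` spectrum (nu G) (laplacian G)))%E) :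
  (forall p : R, 1 < p ->
     equivalent_on (@finitely_supported R V)
       (fun f => lpE G p (edge_diff f)) (fun f => lpV G p (sqrt_laplacian G f))
     /\ equivalent_on (@finitely_supported R V)
       (fun f => lpV G p (sqrt_laplacian G f)) (fun f => lpV G p f))
  /\
  (forall p : R, 2 <= p ->
     exists C : R, 0 < C /\
       forall f : V -> R, finitely_supported f ->
         (lpV G p (gradient G f) <= C%:E * lpV G p (sqrt_laplacian G f))%E).
Proof.
have n0 x : 0 < nu G x by exact: nu_gt0.
have [c c0 deg_le] : exists2 c : R, 0 < c & forall x, deg G x <= c / 2 * nu G x.
  have ub x := ereal_sup_ubound (ex_intro2 _ _ x I erefl :
    range (fun x : V => (deg G x / nu G x)%:E) (deg G x / nu G x)%:E).
  move: hM ub; case: ereal_sup => [M _ ub|//|_ ub]; last first.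
    by exists 1 => // x; have := ub x; rewrite leeNy_eq.
  exists (2 * (`|M| + 1)) => [|x]; first by rewrite mulr_gt0// ltr_wpDl.
  have := ub x; rewrite lee_fin ler_pdivrMr// => /le_trans; apply.
  rewrite (_ : 2 * _ / 2 = `|M| + 1); last by field.
  by rewrite ler_pM2r// (le_trans (ler_norm _))// lerDl.
have res0 : resolvent_set (nu G) (laplacian G) 0.
  apply: contrapT => n0r.
  have : (ereal_inf (EFin @` spectrum (nu G) (laplacian G)) <= 0)%E.
    by apply: ereal_inf_lbound; exists 0.
  by rewrite leNgt hgap.
have [k k01 gap2] := walk_gap2 c0 deg_le res0.
pose w := nu G; pose S := sqrt_series (walk G c) c.
have Wlin := @walk_lin _ _ G c.
have Wsym := walk_sym c0 deg_le.
have fin_l2 f : finitely_supported f -> l2 w f.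
  by move=> ff; apply/l2P; apply: lpow_fin_supp.
have SE f : finitely_supported f -> sqrt_laplacian G f = S f.
  move=> /fin_l2 lf; apply: (op_sqrtE n0 Wlin Wsym k01 gap2 c0) => //.
  by move=> g x _; exact: laplacianE.
(* All comparisons are established for the p-th powers of the norms. *)
have V_le_S p : 1 < p -> exists2 C : R, 0 < C & forall f, finitely_supported f ->
    (lpow w p f <= C%:E * lpow w p (S f))%E.
  move=> p1; have [a a01 gapp] := walk_gap c0 deg_le k01 gap2 p1.
  have [a0 a1] := andP a01; have a01' : 0 <= a < 1 by rewrite ltW.
  have a01'' : 0 <= a <= 1 by rewrite !ltW.
  have [C C0 HC] := lpow_absorb n0 (ltW p1) a01'.
  have s0 : 0 < (Num.sqrt c)^-1 by rewrite invr_gt0 sqrtr_gt0.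
  exists (C * `|(Num.sqrt c)^-1| `^ p).
    by rewrite mulr_gt0// powR_gt0// normr_gt0 gt_eqF.
  move=> f ff; have lf := fin_l2 f ff.
  (* f = Y f + Delta^(1/2) f / sqrt c, where Y contracts the power sum. *)
  pose Y := rtlim (walk G c) f.
  have := HC f Y (fun x => (Num.sqrt c)^-1 * S f x).
  rewrite lpowZ// muleA -EFinM; apply.
  - by apply: lpow_fin_supp => //; rewrite gt_eqF//; lra.
  - move=> x; rewrite /S /sqrt_series mulKf ?subrKC//.
    by rewrite gt_eqF// sqrtr_gt0.
  - exact: (rtlim_lpow n0 Wlin k01 gap2 p1 a01'' gapp lf).
have S_le_V p : 1 < p -> exists2 C : R, 0 < C & forall f, finitely_supported f ->
    (lpow w p (S f) <= C%:E * lpow w p f)%E.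
  move=> p1; have [a a01 gapp] := walk_gap c0 deg_le k01 gap2 p1.
  have [a0 a1] := andP a01; have a01' : 0 <= a <= 1 by rewrite !ltW.
  have [C C0 HC] := sqrt_series_lpow n0 Wlin k01 gap2 c0 p1.
  by exists C => // f /fin_l2 lf; exact: HC a01' gapp lf.
have V_le_E p : 1 < p -> exists2 C : R, 0 < C & forall f, finitely_supported f ->
    (lpow w p f <= C%:E * edge_power G p f)%E.
  move=> p1; have [a a01 gapp] := walk_gap c0 deg_le k01 gap2 p1.
  have [a0 a1] := andP a01; have a01' : 0 <= a < 1 by rewrite ltW.
  have [C C0 HC] := lpow_absorb n0 (ltW p1) a01'.
  pose d := `|c^-1| `^ p * (c `^ p / c) * 2.
  have d0 : 0 < d.
    by rewrite !mulr_gt0 ?powR_gt0 ?normr_gt0 ?invr_gt0// gt_eqF// invr_gt0.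
  exists (C * d); first exact: mulr_gt0.
  move=> f ff.
  (* f = P f + Delta f / c, where P contracts the power sum. *)
  apply: le_trans (HC f (walk G c f) (fun x => c^-1 * laplacian G f x) _ _ _) _.
  - by apply: lpow_fin_supp => //; rewrite gt_eqF//; lra.
  - by move=> x; rewrite (laplacianE G c0) mulKf ?gt_eqF// subrKC.
  - exact: gapp.
  rewrite EFinM -muleA; apply: lee_wpmul2l; first by rewrite lee_fin ltW.
  rewrite lpowZ// /d !EFinM -!muleA; apply: lee_wpmul2l.
    by rewrite lee_fin powR_ge0.
  apply: le_trans (laplacian_lpow c0 deg_le f (ltW p1)) _.
  rewrite EFinM -muleA; apply: lee_wpmul2l; first by rewrite lee_fin powR_ge0.
  apply: lee_wpmul2l; first by rewrite lee_fin invr_ge0 ltW.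
  exact: energy_le_edge_power.
have E_le_V p : 1 < p -> exists2 C : R, 0 < C & forall f, finitely_supported f ->
    (edge_power G p f <= C%:E * lpow w p f)%E.
  move=> p1; exists (2^-1 `^ (1 - p) * c); first by rewrite mulr_gt0// powR_gt0.
  move=> f _; apply: le_trans (edge_power_le_energy _ _ _) _.
  by apply: energy_lpow => //; exact: ltW.
have E_ge0 p f : (0 <= edge_power G p f)%E.
  apply: esum_ge0 => e Ee.
  by rewrite lee_fin mulr_ge0 ?powR_ge0// ltW// mu_gt0.
have trans (a b : R) (x y z : \bar R) : 0 <= a ->
    (x <= a%:E * y)%E -> (y <= b%:E * z)%E -> (x <= (a * b)%:E * z)%E.
  move=> a0 xy yz; apply: le_trans xy _.
  by rewrite EFinM -muleA lee_wpmul2l.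
split=> [p p1|p p2].
  have p0 : 0 < p by lra.
  have [a a0 Ha] := V_le_S p p1; have [b b0 Hb] := S_le_V p p1.
  have [d d0 Hd] := V_le_E p p1; have [e e0 He] := E_le_V p p1.
  split.
    apply: (@equivalent_on_bounds _ _ _ _ _ ((e * a) `^ p^-1) ((b * d) `^ p^-1)).
    - by apply: powR_gt0; exact: mulr_gt0.
    - by apply: powR_gt0; exact: mulr_gt0.
    - move=> f ff; rewrite SE//; apply: poweR_leM => //.
      + by apply: mulr_ge0; exact: ltW.
      + exact: E_ge0.
      + exact: lpow_ge0.
      + exact: trans (ltW e0) (He f ff) (Ha f ff).
    - move=> f ff; rewrite SE//; apply: poweR_leM => //.
      + by apply: mulr_ge0; exact: ltW.
      + exact: lpow_ge0.
      + exact: E_ge0.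
      + exact: trans (ltW b0) (Hb f ff) (Hd f ff).
  apply: (@equivalent_on_bounds _ _ _ _ _ (b `^ p^-1) (a `^ p^-1)).
  - exact: powR_gt0.
  - exact: powR_gt0.
  - move=> f ff; rewrite SE//; apply: poweR_leM (ltW b0) _ _ (Hb f ff) => //.
      exact: lpow_ge0.
    exact: lpow_ge0.
  - move=> f ff; rewrite SE//; apply: poweR_leM (ltW a0) _ _ (Ha f ff) => //.
      exact: lpow_ge0.
    exact: lpow_ge0.
have p0 : 0 < p by lra.
have p1 : 1 < p by lra.
have [a a0 Ha] := V_le_S p p1.
have cp0 : 0 < c `^ (p / 2) by exact: powR_gt0.
exists ((c `^ (p / 2) * a) `^ p^-1); split.
  by apply: powR_gt0; exact: mulr_gt0.
move=> f ff; rewrite SE//; apply: poweR_leM => //.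
- by apply: mulr_ge0; exact: ltW.
- exact: lpow_ge0.
- exact: lpow_ge0.
- exact: trans (ltW cp0) (gradient_lpow c0 deg_le f p2) (Ha f ff).
Qed.
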